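(* For all $H\in(1/4,1/2)\cup(1/2,1)$ and all $t\ge 0$, almost surely $Z^H(t)\in\mathbb{H}$, and for all $p\in\mathbb{N}$ one has \[ \sup_{t\ge 0}\mathbb{E}[\|Z^H(t)\|^{2p}]<\infty. \] Moreover, for all $\alpha\in(0,2H-1/2)$ and all $t\ge 0$, almost surely $Z^H(t)\in\mathbb{H}^\alpha$, and for all $p\in\mathbb{N}$ one has \[ \sup_{t\ge 0}\mathbb{E}[\|Z^H(t)\|_{\mathbb{H}^\alpha}^{2p}]<\infty. \]
   Context: $\mathbb{N}=\{1,2,\ldots\}$. $\mathbb{H}=L^2((0,1);\mathbb{R})$ with norm $\|\cdot\|$. For $k\in\mathbb{N}$, $\lambda_k=k^2\pi^2$, $e_k=\sqrt2\sin(k\pi\cdot)$ (eigenpairs of the operator $Ax=-x''$ on $(0,1)$ with homogeneous Dirichlet boundary conditions). For $\alpha\ge0$, $\mathbb{H}^\alpha=\{x\in\mathbb{H}:\ \|x\|_{\mathbb{H}^\alpha}^2:=\sum_k\lambda_k^\alpha\langle x,e_k\rangle^2<\infty\}$. $S(t)x=\sum_ke^{-\lambda_kt}\langle x,e_k\rangle e_k$ is the semigroup generated by $-A$. $(\beta_k^H)_{k\in\mathbb{N}}$ are independent real-valued fractional Brownian motions with Hurst index $H$ (centered Gaussian, continuous paths, covariance $\frac12(t^{2H}+s^{2H}-|t-s|^{2H})$), and $B^H(t)=\sum_k\beta_k^H(t)e_k$ (formal series) is the cylindrical fractional Brownian motion. For $\phi\in\mathcal{C}^1([0,t])$, $\int_0^t\phi(s)\,d\beta_k^H(s)=\phi(t)\beta_k^H(t)-\int_0^t\phi'(s)\beta_k^H(s)\,ds$.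 The infinite-dimensional fractional Ornstein–Uhlenbeck process is \[ Z^H(t)=\int_0^tS(t-s)\,dB^H(s)=\sum_{k\in\mathbb{N}}\mathcal{Z}_k^H(t)e_k,\qquad \mathcal{Z}_k^H(t)=\int_0^te^{-\lambda_k(t-s)}\,d\beta_k^H(s). \] *)

(* Defs.v *)
From HB Require Import structures.
From mathcomp Require Import all_boot all_order all_algebra finmap.
From mathcomp Require Import all_classical all_reals all_analysis.

Set Implicit Arguments.
Unset Strict Implicit.
Unset Printing Implicit Defensive.

Import Order.TTheory GRing.Theory Num.Theory.
Import numFieldNormedType.Exports.

Local Open Scope classical_set_scope.
Local Open Scope ring_scope.

Section FractionalBrownianMotion.
Context d (T : measurableType d) (R : realType) (P : probability T R).

(* [normal_prob m s] is N(m, s ^ 2) only for [s != 0]. *)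
Definition gaussian_law (m s : R) (A : set R) : \bar R :=
  if s == 0 then \d_m A else normal_prob m s A.

(* The laws are compared on measurable sets only: the values of [P] on
   non-measurable sets are unspecified. *)
Definition gaussian_rv (X : T -> R) : Prop :=
  measurable_fun setT X /\
  exists m s : R, forall A : set R, measurable A ->
    P (X @^-1` A) = gaussian_law m s A.

(* Processes are indexed by the times [t >= 0]; their values at negative times
   play no role. *)
Definition gaussian_process (X : R -> T -> R) : Prop :=
  forall (n : nat) (t a : 'I_n -> R), (forall i, 0 <= t i) ->
    gaussian_rv (fun w => \sum_(i < n) a i * X (t i) w).

Definition fractional_brownian_motion (H : R) (X : R -> T -> R) : Prop :=
  [/\ gaussian_process X,
      forall t, 0 <= t -> ('E_P[X t] = 0)%E,
      forall t s, 0 <= t -> 0 <= s ->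
        covariance P (X t) (X s) =
        (2^-1 * (t `^ (2 * H) + s `^ (2 * H) - `|t - s| `^ (2 * H)))%:E
    & forall w, {within `[0, +oo[, continuous (fun t => X t w)}].

Definition sigma_process (X : R -> T -> R) : set_system T :=
  <<s [set X t @^-1` A | t in `[0, +oo[ & A in @measurable _ R] >>.

Definition independent_processes (I : choiceType) (D : set I)
    (X : I -> R -> T -> R) : Prop :=
  forall (J : {fset I}) (A : I -> set T),
    [set` J] `<=` D ->
    (forall i, i \in J -> sigma_process (X i) (A i)) ->
    P (\bigcap_(i in [set` J]) A i) = (\prod_(i <- J) P (A i))%E.

End FractionalBrownianMotion.

Section Spaces.
Context (R : realType).

Definition lebesgue01 : {measure set (measurableTypeR R) -> \bar R} :=
  mrestr (@lebesgue_measure R) (measurable_itv `]0%R, 1%R[).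

Definition L2_01 := LspaceType2 lebesgue01.

Definition L2_norm (f : R -> R) : \bar R := 'N[lebesgue01]_2%:E[EFin \o f]%E.

Definition L2_inner (f g : R -> R) : R := \int[lebesgue01]_u (f u * g u).

(* The eigenpairs are meant for [1 <= k]. *)
Definition dirichlet_eigenvalue (k : nat) : R := k%:R ^+ 2 * pi ^+ 2.

Definition dirichlet_eigenfun (k : nat) (u : R) : R :=
  Num.sqrt 2 * sin (k%:R * pi * u).

Definition sobolev_norm (alpha : R) (x : L2_01) : \bar R :=
  ((\sum_(1 <= k <oo)
      (dirichlet_eigenvalue k `^ alpha *
       L2_inner x (dirichlet_eigenfun k) ^+ 2)%:E) `^ 2^-1)%E.

Definition sobolev (alpha : R) : set L2_01 :=
  [set x | (sobolev_norm alpha x < +oo)%E].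

(* A formal series [\sum_(k >= 1) c k * e_k], with e_k the k-th eigenfunction,
   is given by its coefficients [c k], [1 <= k]; it belongs to a subspace of
   L^2(0,1) when it converges in L^2(0,1) to an element of this subspace. *)
Definition formal_sum (c : nat -> R) : set L2_01 :=
  [set x | L2_norm (fun u =>
               x u - \sum_(1 <= k < n.+1) c k * dirichlet_eigenfun k u)
             @[n --> \oo] --> 0%E].

Definition formal_in (V : set L2_01) (c : nat -> R) : Prop :=
  exists2 x, V x & formal_sum c x.

(* The norm of the sum of the series, which is unique as an element of
   L^2(0,1), and [+oo] (the infimum of the empty set) if the series does not
   converge in L^2(0,1). *)
Definition formal_norm (N : L2_01 -> \bar R) (c : nat -> R) : \bar R :=
  ereal_inf [set N x | x in formal_sum c].

End Spaces.

Section OrnsteinUhlenbeck.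
Context (R : realType).

(* The integral of [phi] of class C^1 against [d b] over [0, t], defined by
   integration by parts; there is no boundary term at 0 because a fractional
   Brownian motion vanishes there almost surely. *)
Definition path_integral (phi b : R -> R) (t : R) : R :=
  phi t * b t - \int[lebesgue_measure]_(s in `[0, t]) (derive1 phi s * b s).

(* The coefficient sequence, in the sense of [formal_sum], of the fractional
   Ornstein-Uhlenbeck process at time [t]. *)
Definition fOU (T : Type) (beta : nat -> R -> T -> R) (t : R) (w : T)
    (k : nat) : R :=
  path_integral (fun s => expR (- dirichlet_eigenvalue R k * (t - s)))
                (fun s => beta k s w) t.

End OrnsteinUhlenbeck.

(* Main.v *)
Require Import Defs.
From HB Require Import structures.
From mathcomp Require Import all_boot all_order all_algebra finmap.
From mathcomp Require Import all_classical all_reals all_analysis.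
From mathcomp Require Import measurable_realfun ring lra.

Set Implicit Arguments.
Unset Strict Implicit.
Unset Printing Implicit Defensive.

Import Order.TTheory GRing.Theory Num.Theory.
Import numFieldNormedType.Exports.

Local Open Scope classical_set_scope.
Local Open Scope ring_scope.

(** The coefficient of index [k] of the process at time [t], with
    [l = dirichlet_eigenvalue R k], is

      [X t - int_0^t l exp (- l (t - s)) X s ds],

    which equals

      [exp (- l t) X t + int_0^t l exp (- l (t - s)) (X t - X s) ds],

    where [X = beta k].  As [X 0 = 0] almost surely, this is the average of the
    increments [X t - X s] for the probability measure on [[0, t]] that has an
    atom of mass [exp (- l t)] at [0] and density [l exp (- l (t - s))].  By
    Jensen's inequality its moment of order [2 p] is at most the average of the
    moments of the increments.  An increment is Gaussian of variance
    [|t - s|^(2 H)], so its moment is [O(|t - s|^(2 H p))]; averaging gives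
    [O(l^(- 2 H p))], uniformly in [t] ([fOU_moment_le]).  The integral is
    handled through Riemann sums and Fatou's lemma, so that only finitely many
    times are used at once and no joint measurability of the paths in time and
    chance has to be discussed.

    Convexity is used a second time to pass to the sum over [k].  With
    [g = 2 H - alpha] and weights proportional to [l_k^(- g)], Jensen's
    inequality bounds [(sum_k l_k^alpha c_k^2)^p] by a random variable [D], a
    multiple of [sum_k l_k^(- g) l_k^(2 H p) c_k^(2 p)], whose expectation is
    at most a multiple of [sum_k l_k^(- g)].  That series converges because
    [alpha < 2 H - 1/2] means [g > 1/2] and [l_k >= k^2]
    ([fOU_weighted_sum_dominated]).

    The remaining part is deterministic.  Wherever [D] is finite the
    coefficients are square summable, so completeness of the space of
    square-integrable functions ([L2_complete]) and orthonormality of the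
    eigenfunctions ([L2_inner_eigenfun]) produce the sum of the formal series
    and bound its norms ([formal_in_sobolev], [formal_norm_sobolev_le],
    [formal_norm_L2_le]); wherever [D] is infinite it bounds every norm.  Thus
    [D] dominates the power of the norm at every point, which also dispenses
    with the measurability of the norm. *)

(** * Inequalities for powers and sums *)
Section RealInequalities.
Context (R : realType).
Implicit Types (a y : R).

(** The tangent line at [a] to a power function lies below its graph; this is
    the form in which convexity enters Jensen's inequality. *)
Lemma exprS_tangent (n : nat) (a y : R) : 0 <= a -> 0 <= y ->
  a ^+ n.+1 + n.+1%:R * a ^+ n * (y - a) <= y ^+ n.+1.
Proof.
move=> a0 y0; elim: n => [|n IH]; first by rewrite expr0 !expr1; lra.
rewrite (exprS y) (le_trans _ (ler_wpM2l y0 IH))//.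
rewrite !exprS -(natr1 n.+1).
have h : 0 <= n.+1%:R * a ^+ n * (y - a) ^+ 2.
  by apply: mulr_ge0; rewrite ?sqr_ge0// mulr_ge0// exprn_ge0.
rewrite -subr_ge0 (le_trans h)// le_eqVlt; apply/orP; left; apply/eqP.
ring.
Qed.

(** Total mass at most [1] is enough because the exponent is at least [1]: the
    missing mass can be put at the value [0].  Partial sums of a probability
    on an infinite set are of this kind. *)
Lemma jensen_exprS (I : Type) (r : seq I) (w y : I -> R) (n : nat) :
  (forall i, 0 <= w i) -> (forall i, 0 <= y i) -> \sum_(i <- r) w i <= 1 ->
  (\sum_(i <- r) w i * y i) ^+ n.+1 <= \sum_(i <- r) w i * y i ^+ n.+1.
Proof.
move=> w0 y0 w1; have [a aE] : exists a, a = \sum_(i <- r) w i * y i by eexists.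
rewrite -aE; have a0 : 0 <= a by rewrite aE; apply: sumr_ge0 => i _; rewrite mulr_ge0.
have : \sum_(i <- r) w i * (a ^+ n.+1 + n.+1%:R * a ^+ n * (y i - a))
       <= \sum_(i <- r) w i * y i ^+ n.+1.
  by apply: ler_sum => i _; rewrite ler_wpM2l// exprS_tangent.
apply: le_trans.
have linE (b c : R) : \sum_(i <- r) w i * (b + c * (y i - a)) =
    (\sum_(i <- r) w i) * (b - c * a) + c * a.
  transitivity ((\sum_(i <- r) w i) * (b - c * a) + c * \sum_(i <- r) w i * y i).
    rewrite mulr_suml mulr_sumr -big_split/=.
    by apply: eq_bigr => i _; ring.
  by rewrite -aE.
rewrite linE.
have h : 0 <= n%:R * a ^+ n.+1 * (1 - \sum_(i <- r) w i).
  by rewrite !mulr_ge0 ?exprn_ge0// subr_ge0.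
rewrite -subr_ge0 (le_trans h)// le_eqVlt; apply/orP; left; apply/eqP.
by rewrite -(natr1 n) exprS; ring.
Qed.

Lemma jensen_expr_even (I : Type) (r : seq I) (w x : I -> R) (p : nat) :
  (0 < p)%N -> (forall i, 0 <= w i) -> \sum_(i <- r) w i <= 1 ->
  (\sum_(i <- r) w i * x i) ^+ (2 * p) <= \sum_(i <- r) w i * x i ^+ (2 * p).
Proof.
move=> p0 w0 w1.
have evenE (z : R) : z ^+ (2 * p) = `|z| ^+ (2 * p).
  by rewrite !exprM -[z ^+ 2]ger0_norm ?sqr_ge0// normrX.
under [leRHS]eq_bigr do rewrite evenE.
rewrite evenE; have : (0 < 2 * p)%N by rewrite muln_gt0.
case: (2 * p)%N => // n _.
apply: le_trans (jensen_exprS n w0 (fun i => normr_ge0 (x i)) w1).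
rewrite lerXn2r ?nnegrE ?sumr_ge0//; first by move=> i _; rewrite mulr_ge0.
apply: le_trans (ler_norm_sum _ _ _) _; apply: ler_sum => i _.
by rewrite normrM ger0_norm.
Qed.

(** From [1 + ln z <= z] at [z = u c / q], multiplied by [q]. *)
Lemma powR_le_expR (q c : R) : 0 < q -> 0 < c ->
  exists2 K : R, 0 <= K & forall u, 0 <= u -> u `^ q <= K * expR (c * u).
Proof.
move=> q0 c0; exists (expR (q * ln (q / c))); first exact: expR_ge0.
move=> u; rewrite le_eqVlt => /predU1P[<-|u0].
  by rewrite powR0 ?gt_eqF// mulr_ge0 ?expR_ge0.
have qc : 0 < q / c by rewrite divr_gt0.
rewrite /powR gt_eqF// -expRD ler_expR.
have : 1 + ln (u / (q / c)) <= u / (q / c).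
  by rewrite (le_trans (expR_ge1Dx _))// lnK// posrE divr_gt0.
rewrite (@ln_div _ u) ?posrE// => h.
have : q * (1 + (ln u - ln (q / c))) <= q * (u / (q / c)) by rewrite ler_pM2l.
have -> : q * (u / (q / c)) = c * u.
  by field; rewrite !gt_eqF.
by lra.
Qed.

(** Telescoping replaces the integral test: with [r = s - 1],
    [r k^(- s) <= (k - 1)^(- r) - k^(- r)], which amounts to
    [1 + r / k <= (1 - 1 / k)^(- r)]. *)
Lemma powR_sum_bounded (s : R) : 1 < s ->
  exists2 M : R, 0 < M &
    forall n, \sum_(1 <= k < n) (k%:R : R) `^ (- s) <= M.
Proof.
move=> s1; pose r := s - 1; have r0 : 0 < r by rewrite subr_gt0.
have step (k : nat) : (0 < k)%N ->
    r * (k.+1%:R : R) `^ (- s) <= k%:R `^ (- r) - k.+1%:R `^ (- r).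
  move=> k0; have k0' : 0 < k%:R :> R by rewrite ltr0n.
  have -> : - s = - r + (-1) by rewrite /r; lra.
  rewrite powRD ?pnatr_eq0 ?implybT// powR_inv1//.
  have -> : k%:R `^ (- r) = k.+1%:R `^ (- r) * ((k%:R / k.+1%:R) `^ (- r)) :> R.
    by rewrite -powRM// ?divr_ge0// mulrC divfK// pnatr_eq0.
  have : 1 + r * k.+1%:R^-1 <= (k%:R / k.+1%:R) `^ (- r) :> R.
    rewrite /powR mulf_eq0 invr_eq0 !pnatr_eq0 (gtn_eqF k0)/=.
    apply: le_trans (expR_ge1Dx _); rewrite lerD2l mulNr -mulrN ler_wpM2l ?(ltW r0)//.
    have : 1 + ln (k%:R / k.+1%:R) <= (k%:R / k.+1%:R) :> R.
      by rewrite (le_trans (expR_ge1Dx _))// lnK// posrE divr_gt0.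
    have -> : k%:R / k.+1%:R = 1 - k.+1%:R^-1 :> R.
      by rewrite -natr1; field; rewrite natr1 pnatr_eq0.
    by rewrite -lerBrDl addrAC subrr sub0r lerNr.
  move/(ler_wpM2l (powR_ge0 k.+1%:R (- r))); rewrite mulrDr mulr1 mulrCA => ?.
  by rewrite lerBrDl.
have sumk n : r * (\sum_(2 <= k < n.+2) (k%:R : R) `^ (- s)) <= 1 - n.+1%:R `^ (- r).
  elim: n => [|n IH]; first by rewrite big_geq// mulr0 powR1 subrr.
  by rewrite big_nat_recr//= mulrDr; have := step n.+1 isT; lra.
exists (1 + r^-1); first by rewrite addr_gt0// invr_gt0.
have M0 : 0 <= 1 + r^-1 by rewrite addr_ge0// invr_ge0 ltW.
case=> [|[|n]]; [by rewrite big_geq|by rewrite big_geq|].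
rewrite big_ltn// powR1 lerD2l -(ler_pM2l r0) divff ?gt_eqF//.
by apply: le_trans (sumk n) _; rewrite lerBlDr lerDl powR_ge0.
Qed.
End RealInequalities.

(** * Even moments of Gaussian variables *)
Section GaussianMoments.
Context (R : realType).
Local Notation mu := (@lebesgue_measure R).

(** The Radon-Nikodym derivative of the normal law is its density. *)
Lemma ge0_integral_normal_prob (m s : R) (f : measurableTypeR R -> \bar R) :
  measurable_fun [set: R] f -> (forall x, 0 <= f x)%E ->
  (\int[normal_prob m s]_x f x = \int[mu]_x (f x * (normal_pdf m s x)%:E))%E.
Proof.
move=> mf f0; have dom := normal_prob_dominates m s.
rewrite -(Radon_Nikodym_SigmaFinite.change_of_variables dom)//.
have iRN := Radon_Nikodym_SigmaFinite.f_integrable dom.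
have mpdf : measurable_fun [set: R] (fun x => (normal_pdf m s x)%:E).
  by apply/measurable_EFinP; exact: measurable_normal_pdf.
apply: ae_eq_integral => //.
- by apply: emeasurable_funM => //; exact: measurable_int iRN.
- exact: emeasurable_funM.
- apply: ae_eqe_mul2l; apply: integral_ae_eq => // E _ mE.
  by rewrite -Radon_Nikodym_SigmaFinite.f_integral.
Qed.

(** A power is absorbed by half of the Gaussian exponent, at the price of
    doubling the variance.  Integrating this gives all moments without
    computing any of them. *)
Lemma normal_pdf_moment_le (p : nat) : (0 < p)%N ->
  exists2 K : R, 0 <= K & forall m s x, s != 0 ->
    (x - m) ^+ (2 * p) * normal_pdf m s x
    <= K * s ^+ (2 * p) * normal_pdf m (Num.sqrt 2 * s) x.
Proof.
move=> p0.
have [K K0 HK] := @powR_le_expR R p%:R 2^-1 ltac:(by rewrite ltr0n)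
  ltac:(by rewrite invr_gt0).
exists (2 ^+ p * K * Num.sqrt 2); first by rewrite !mulr_ge0// exprn_ge0.
move=> m s x s0.
have s20 : Num.sqrt 2 != 0 :> R by rewrite gt_eqF// sqrtr_gt0.
rewrite !normal_pdfE ?mulf_neq0// /normal_peak /normal_fun.
have s2 : 0 < s ^+ 2 by rewrite exprn_even_gt0.
pose u := (x - m) ^+ 2 / (s ^+ 2 *+ 2).
have u0 : 0 <= u by rewrite divr_ge0 ?sqr_ge0// mulrn_wge0// ltW.
have E1 : (x - m) ^+ (2 * p) = 2 ^+ p * s ^+ (2 * p) * u ^+ p.
  rewrite !exprM -!exprMn; congr (_ ^+ _); rewrite /u.
  by field; rewrite s0.
have E2 : - (x - m) ^+ 2 / (s ^+ 2 *+ 2) = - u by rewrite mulNr.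
have E3 : - (x - m) ^+ 2 / ((Num.sqrt 2 * s) ^+ 2 *+ 2) = - u + 2^-1 * u.
  rewrite exprMn sqr_sqrtr// /u; field; rewrite s0.
  by [].
rewrite E1 E2 E3.
have -> : Num.sqrt ((Num.sqrt 2 * s) ^+ 2 * pi *+ 2) =
          Num.sqrt 2 * Num.sqrt (s ^+ 2 * pi *+ 2).
  by rewrite exprMn sqr_sqrtr// -mulrA -mulrnAr sqrtrM.
rewrite expRD invfM.
have := HK u u0; rewrite powR_mulrn// => uK.
set e := expR (- u); set q := (Num.sqrt _)^-1; set S := s ^+ (2 * p).
have S0 : 0 <= S by rewrite /S exprM exprn_ge0// sqr_ge0.
have -> : 2 ^+ p * K * Num.sqrt 2 * S * ((Num.sqrt 2)^-1 * q * (e * expR (2^-1 * u)))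
   = 2 ^+ p * S * (K * expR (2^-1 * u)) * (q * e) by field.
apply: ler_wpM2r; first by rewrite mulr_ge0 ?expR_ge0// invr_ge0 sqrtr_ge0.
by apply: ler_wpM2l => //; rewrite mulr_ge0// exprn_ge0.
Qed.

(** On an interval of length [|s|] on the far side of [m] from [0], at distance
    between [|s|] and [2 |s|] from [m], the density is at least a constant over
    [|s|] and [x^2 >= (|m| + |s|)^2]. *)
Lemma normal_prob_sqr_ge :
  exists2 c : R, 0 < c & forall m s, s != 0 ->
    ((c * (m ^+ 2 + s ^+ 2))%:E <= \int[normal_prob m s]_x (x ^+ 2)%:E)%E.
Proof.
exists ((Num.sqrt (pi *+ 2))^-1 * expR (- 2)).
  by rewrite mulr_gt0 ?expR_gt0// invr_gt0 sqrtr_gt0 mulrn_wgt0// pi_gt0.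
move=> m s s0; rewrite ge0_integral_normal_prob//; last 2 first.
- by apply/measurable_EFinP; exact: measurable_funX.
- by move=> x; rewrite lee_fin sqr_ge0.
have ns : 0 < `|s| by rewrite normr_gt0.
pose a := if 0 <= m then m + `|s| else m - 2 * `|s|.
pose I := `[a, a + `|s|]%classic.
have mI : measurable I by exact: measurable_itv.
have mf : measurable_fun [set: R] (fun x : R => ((x ^+ 2)%:E * (normal_pdf m s x)%:E)%E).
  apply: emeasurable_funM; apply/measurable_EFinP; first exact: measurable_funX.
  exact: measurable_normal_pdf.
have f0 x : (0 <= (x ^+ 2)%:E * (normal_pdf m s x)%:E)%E.
  by rewrite -EFinM lee_fin mulr_ge0 ?sqr_ge0 ?normal_pdf_ge0.
apply: (@le_trans _ _
  (\int[mu]_(x in I) ((x ^+ 2)%:E * (normal_pdf m s x)%:E))%E); last first.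
  by apply: ge0_subset_integral.
pose k := normal_peak s * expR (-2) * (m ^+ 2 + s ^+ 2).
have -> : ((Num.sqrt (pi *+ 2))^-1 * expR (- 2) * (m ^+ 2 + s ^+ 2))%:E =
    (\int[mu]_(x in I) (cst k%:E x))%E.
  rewrite integral_cst//= /I lebesgue_measure_itv/= lte_fin ltrDl ns.
  rewrite -EFinB -EFinM addrAC subrr add0r /k /normal_peak.
  rewrite -mulrnAr sqrtrM ?sqr_ge0// sqrtr_sqr; congr EFin; field.
  by rewrite normr_eq0 s0 gt_eqF// sqrtr_gt0 mulrn_wgt0// pi_gt0.
apply: ge0_le_integral => //.
- by move=> x _; rewrite lee_fin /k !mulr_ge0 ?normal_peak_ge0 ?expR_ge0 ?addr_ge0 ?sqr_ge0.
- exact: measurable_funTS.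
move=> x; rewrite /I/= in_itv/= => /andP[ax xa].
rewrite -EFinM lee_fin /k mulrC normal_pdfE//.
have x2 : m ^+ 2 + s ^+ 2 <= x ^+ 2.
  rewrite -(real_normK (num_real s)).
  move: ax xa; rewrite /a; case: ifPn => [m0|]; last rewrite -ltNge => m0; nra.
have xm : (x - m) ^+ 2 <= 4 * s ^+ 2.
  rewrite -(real_normK (num_real s)).
  move: ax xa; rewrite /a; case: ifPn => [m0|]; last rewrite -ltNge => m0; nra.
apply: ler_pM => //; rewrite ?addr_ge0 ?sqr_ge0// ?mulr_ge0 ?expR_ge0 ?normal_peak_ge0//.
rewrite ler_wpM2l ?normal_peak_ge0// /normal_fun ler_expR mulNr lerN2.
by rewrite ler_pdivrMr ?mulrn_wgt0 ?exprn_even_gt0// -mulr_natl; lra.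
Qed.

Lemma normal_prob_moment_le (p : nat) : (0 < p)%N ->
  exists2 C : R, 0 <= C & forall m s, s != 0 ->
    (\int[normal_prob m s]_x (x ^+ (2 * p))%:E <= (C * (m ^+ 2 + s ^+ 2) ^+ p)%:E)%E.
Proof.
move=> p0; have [K K0 HK] := normal_pdf_moment_le p0.
exists (2 ^+ (2 * p) * (K + 1)); first by rewrite mulr_ge0 ?exprn_ge0// addr_ge0.
move=> m s s0.
have p2 x : 0 <= x ^+ (2 * p) :> R by rewrite exprM exprn_ge0// sqr_ge0.
rewrite ge0_integral_normal_prob//; last first.
  by apply/measurable_EFinP; exact: measurable_funX.
have s20 : Num.sqrt 2 * s != 0 :> R by rewrite mulf_neq0// gt_eqF// sqrtr_gt0.
pose A := 2 ^+ (2 * p) * (K * s ^+ (2 * p)); pose B : R := 2 ^+ (2 * p) * m ^+ (2 * p).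
have A0 : 0 <= A by rewrite mulr_ge0 ?p2// mulr_ge0 ?p2.
have B0 : 0 <= B by rewrite mulr_ge0 ?p2.
have mpdf m' s' : measurable_fun [set: R] (fun x => (normal_pdf m' s' x)%:E).
  by apply/measurable_EFinP; exact: measurable_normal_pdf.
apply: (@le_trans _ _ (\int[mu]_x (A%:E * (normal_pdf m (Num.sqrt 2 * s) x)%:E
    + B%:E * (normal_pdf m s x)%:E))%E).
  have mx2 : measurable_fun [set: R] (fun x : R => (x ^+ (2 * p))%:E).
    by apply/measurable_EFinP; exact: measurable_funX.
  apply: ge0_le_integral.
  - exact: measurableT.
  - by move=> x _; rewrite -EFinM lee_fin mulr_ge0 ?normal_pdf_ge0.
  - by apply: emeasurable_funM; [exact: mx2|exact: mpdf].
  - by apply: emeasurable_funD; apply: emeasurable_funM;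
      (exact: mpdf || exact: measurable_cst).
  move=> x _; rewrite -!EFinM -EFinD lee_fin.
  have pdf0 := normal_pdf_ge0 m s x.
  have xle : x ^+ (2 * p) <= 2 ^+ (2 * p) * ((x - m) ^+ (2 * p) + m ^+ (2 * p)).
    have := @jensen_expr_even R bool [:: true; false] (fun=> 2^-1)
      (fun b => if b then 2 * (x - m) else 2 * m) p p0.
    rewrite !big_cons !big_nil /= !addr0 => /(_ (fun _ => ltac:(by rewrite invr_ge0))).
    have -> : 2^-1 * (2 * (x - m)) + 2^-1 * (2 * m) = x by field.
    move=> /(_ ltac:(lra)) /le_trans; apply.
    rewrite !(exprMn _ 2) mulrDr.
    have c0 : 0 <= 2 ^+ (2 * p) :> R by rewrite exprn_ge0.
    by have := mulr_ge0 c0 (p2 (x - m)); have := mulr_ge0 c0 (p2 m); lra.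
  rewrite /A /B -!mulrA -mulrDr.
  apply: le_trans (ler_wpM2r pdf0 xle) _.
  rewrite -mulrA ler_pM2l ?exprn_gt0// mulrDl lerD2r.
  by rewrite mulrA HK.
rewrite ge0_integralD//; last 4 first.
- by move=> x _; rewrite -EFinM lee_fin mulr_ge0 ?normal_pdf_ge0.
- by apply: emeasurable_funM; (exact: mpdf || exact: measurable_cst).
- by move=> x _; rewrite -EFinM lee_fin mulr_ge0 ?normal_pdf_ge0.
- by apply: emeasurable_funM; (exact: mpdf || exact: measurable_cst).
have Z c m' s' : 0 <= c -> (\int[mu]_x (c%:E * (normal_pdf m' s' x)%:E) = c%:E)%E.
  move=> c0; rewrite ge0_integralZl//; try exact: mpdf.
    by rewrite integral_normal_pdf mule1.
  by move=> x _; rewrite lee_fin normal_pdf_ge0.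
rewrite !Z// -EFinD lee_fin /A /B -mulrDr -mulrA.
rewrite ler_pM2l ?exprn_gt0// mulrDl mul1r.
have h a b : 0 <= a -> a <= b -> a ^+ p <= b ^+ p :> R.
  by move=> a0 ab; rewrite lerXn2r// nnegrE// (le_trans a0).
by apply: lerD; [apply: ler_wpM2l => //|]; rewrite exprM h ?sqr_ge0// ?lerDl ?lerDr sqr_ge0.
Qed.

(** The constant depends on the exponent only.  The mean is arbitrary, as both
    sides are comparable to powers of [m^2 + s^2]; a degenerate law is a Dirac
    mass. *)
Lemma gaussian_rv_moment_le (p : nat) : (0 < p)%N ->
  exists2 C : R, 0 <= C &
    forall d (T : measurableType d) (P : probability T R) (X : T -> R) (v : R),
      gaussian_rv P X -> (\int[P]_w (X w ^+ 2)%:E <= v%:E)%E ->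
      (\int[P]_w (X w ^+ (2 * p))%:E <= (C * v ^+ p)%:E)%E.
Proof.
move=> p0; have [C C0 HC] := normal_prob_moment_le p0.
have [c c0 Hc] := normal_prob_sqr_ge.
exists (1 + C / c ^+ p); first by rewrite addr_ge0// divr_ge0// exprn_ge0// ltW.
move=> d T P X v [mX [m [s law]]] Xv.
have p2 x : 0 <= x ^+ (2 * p) :> R by rewrite exprM exprn_ge0// sqr_ge0.
have v0 : 0 <= v.
  by rewrite -lee_fin (le_trans _ Xv)// integral_ge0// => x _; rewrite lee_fin sqr_ge0.
(* the Borel sets of R carry another display in [measurableTypeR R] *)
have mX' : measurable_fun [set: T] (X : T -> measurableTypeR R) := mX.
have transfer (nu : {measure set (measurableTypeR R) -> \bar R})
    (f : measurableTypeR R -> \bar R) :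
    (forall A : set R, measurable A -> P (X @^-1` A) = nu A) ->
    measurable_fun [set: R] f -> (forall x, 0 <= f x)%E ->
    (\int[P]_w f (X w) = \int[nu]_x f x)%E.
  move=> PX mf f0.
  rewrite -(@ge0_integral_pushforward _ _ _ _ _ _ mX' P setT f)//; last first.
  by apply: eq_measure_integral => A mA _; rewrite -PX.
have mX2 n : measurable_fun [set: R] (fun x : R => (x ^+ n)%:E).
  by apply/measurable_EFinP; exact: measurable_funX.
have h a b : 0 <= a -> a <= b -> a ^+ p <= b ^+ p :> R.
  by move=> a0 ab; rewrite lerXn2r// nnegrE// (le_trans a0).
move: law; rewrite /gaussian_law; case: eqVneq => [_ law|s0 law].
  have E n : ~~ odd n -> (\int[P]_w (X w ^+ n)%:E = (m ^+ n)%:E)%E.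
    move=> en; rewrite (transfer (@dirac _ (measurableTypeR R) m R)
      (fun x => (x ^+ n)%:E) law (mX2 n))//.
      rewrite integral_dirac//; last exact: mX2.
      by rewrite [X in (X * _)%E]diracT mul1e.
    by move=> x; rewrite lee_fin exprn_even_ge0.
  rewrite E ?oddM// lee_fin; move: Xv; rewrite E// lee_fin => mv.
  rewrite exprM (le_trans (h _ _ (sqr_ge0 _) mv))// ler_peMl ?exprn_ge0//.
  by rewrite lerDl divr_ge0// exprn_ge0// ltW.
rewrite (transfer (normal_prob m s)
  (fun x => (x ^+ (2 * p))%:E) law (mX2 _)); last first.
  by move=> x; rewrite lee_fin.
move: Xv; rewrite (transfer (normal_prob m s)
  (fun x => (x ^+ 2)%:E) law (mX2 _)); last first.
  by move=> x; rewrite lee_fin sqr_ge0.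
move=> /(le_trans (Hc m s s0)); rewrite lee_fin => cv.
apply: le_trans (HC m s s0) _; rewrite lee_fin.
have cc : m ^+ 2 + s ^+ 2 <= v / c by rewrite ler_pdivlMr// mulrC.
have := h _ _ (addr_ge0 (sqr_ge0 m) (sqr_ge0 s)) cc.
rewrite expr_div_n => hh; rewrite mulrDl mul1r -mulrA (mulrC _ (v ^+ p)).
apply: le_trans (ler_wpM2l C0 hh) _.
by rewrite lerDr exprn_ge0.
Qed.

End GaussianMoments.

(** * Increments of fractional Brownian motion *)
Section FractionalBrownianIncrements.
Context d (T : measurableType d) (R : realType) (P : probability T R).
Context (H : R) (X : R -> T -> R).
Context (H0 : 0 < H).
Context (fbmX : fractional_brownian_motion P H X).

Lemma fbm_gaussian (t : R) : 0 <= t -> gaussian_rv P (X t).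
Proof.
move=> t0; have [G _ _ _] := fbmX.
have := G 1%N (fun=> t) (fun=> 1) (fun=> t0).
by congr gaussian_rv; apply/funext => w; rewrite big_ord1 mul1r.
Qed.

Lemma fbm_increment_gaussian (t s : R) : 0 <= t -> 0 <= s ->
  gaussian_rv P (fun w => X t w - X s w).
Proof.
move=> t0 s0; have [G _ _ _] := fbmX.
have := G 2%N (fun i => if i == ord0 then t else s)
  (fun i => if i == ord0 then 1 else -1).
have -> : (fun w : T => \sum_(i < 2) (if i == ord0 then 1 else -1) *
             X (if i == ord0 then t else s) w) = (fun w => X t w - X s w).
  by apply/funext => w; rewrite !big_ord_recl big_ord0/= mul1r mulN1r addr0.
by apply=> i; case: ifP.
Qed.

Lemma fbm_measurable (t : R) : 0 <= t -> measurable_fun setT (X t).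
Proof. by move=> /fbm_gaussian[]. Qed.

Lemma fbm_covariance (t s : R) : 0 <= t -> 0 <= s ->
  (\int[P]_w (X t w * X s w)%:E =
   (2^-1 * (t `^ (2 * H) + s `^ (2 * H) - `|t - s| `^ (2 * H)))%:E)%E.
Proof.
move=> t0 s0; have [_ E C _] := fbmX; rewrite -C// unlock !E//= unlock.
by apply: eq_integral => w _ /=; rewrite !fctE/= !subr0.
Qed.

Lemma fbm_sqr (t : R) : 0 <= t ->
  (\int[P]_w (X t w ^+ 2)%:E = (t `^ (2 * H))%:E)%E.
Proof.
move=> t0; under eq_integral do rewrite expr2.
rewrite fbm_covariance// subrr normr0 powR0 ?subr0; last first.
  by rewrite mulf_neq0// gt_eqF.
by congr EFin; field.
Qed.

Lemma fbm_mul_integrable (t s : R) : 0 <= t -> 0 <= s ->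
  P.-integrable setT (fun w => (X t w * X s w)%:E).
Proof.
have sq u : 0 <= u -> P.-integrable setT (fun w => (X u w ^+ 2)%:E).
  move=> u0; apply/integrableP; split.
    by apply/measurable_EFinP; apply: measurable_funX; exact: fbm_measurable.
  under eq_integral => w _ do rewrite gee0_abs ?lee_fin ?sqr_ge0//.
  by rewrite fbm_sqr// ltry.
move=> t0 s0.
apply: (@le_integrable _ _ _ _ _ _ _
  (fun w => (X t w ^+ 2)%:E + (X s w ^+ 2)%:E)%E) => //.
- by apply/measurable_EFinP; apply: measurable_funM; exact: fbm_measurable.
- move=> w _; rewrite -EFinD !abse_EFin lee_fin normrM.
  rewrite (ger0_norm (addr_ge0 (sqr_ge0 _) (sqr_ge0 _))).
  rewrite -(real_normK (num_real (X t w))) -(real_normK (num_real (X s w))).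
  have := sqr_ge0 (`|X t w| - `|X s w|).
  have := sqr_ge0 (`|X t w|); have := sqr_ge0 (`|X s w|); nra.
- by apply: integrableD => //; exact: sq.
Qed.

Lemma fbm_increment_sqr (t s : R) : 0 <= t -> 0 <= s ->
  (\int[P]_w ((X t w - X s w) ^+ 2)%:E = (`|t - s| `^ (2 * H))%:E)%E.
Proof.
move=> t0 s0.
transitivity (\int[P]_w ((X t w * X t w)%:E +
   ((X s w * X s w)%:E + (- 2)%:E * (X t w * X s w)%:E)))%E.
  by apply: eq_integral => w _; rewrite -EFinM -!EFinD; congr EFin; ring.
have it := fbm_mul_integrable.
rewrite integralD//; [|exact: it|]; last first.
  by apply: integrableD => //; [exact: it|apply: integrableZl => //; exact: it].
rewrite integralD//; [|exact: it|]; last by apply: integrableZl => //; exact: it.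
rewrite integralZl//; last exact: it.
rewrite !fbm_covariance// !subrr normr0 powR0 ?subr0; last first.
  by rewrite mulf_neq0// gt_eqF.
by rewrite -EFinM -!EFinD; congr EFin; field.
Qed.

End FractionalBrownianIncrements.

Lemma fbm_increment_moment_le (R : realType) (p : nat) : (0 < p)%N ->
  exists2 C : R, 0 <= C &
    forall d (T : measurableType d) (P : probability T R) (H : R) (X : R -> T -> R),
      0 < H -> fractional_brownian_motion P H X -> forall t s, 0 <= t -> 0 <= s ->
      (\int[P]_w (X t w ^+ (2 * p))%:E <= (C * (t `^ (2 * H)) ^+ p)%:E)%E /\
      (\int[P]_w ((X t w - X s w) ^+ (2 * p))%:E <=
        (C * (`|t - s| `^ (2 * H)) ^+ p)%:E)%E.
Proof.
move=> p0; have [C C0 HC] := gaussian_rv_moment_le R p0.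
exists C => // d T P H X H0 fX t s t0 s0; split; apply: HC.
- exact: fbm_gaussian fX _ t0.
- by rewrite (fbm_sqr H0 fX).
- exact: fbm_increment_gaussian fX _ _ t0 s0.
- by rewrite (fbm_increment_sqr H0 fX).
Qed.

(** * Approximation of integrals *)

(** Fatou's lemma for a pointwise limit. *)
Lemma integral_lim_le d (T : measurableType d) (R : realType)
    (mu : {measure set T -> \bar R}) (f_ : nat -> T -> R) (f : T -> R)
    (B : \bar R) :
  (forall n, measurable_fun setT (f_ n)) -> (forall n x, 0 <= f_ n x) ->
  (forall x, f_ ^~ x @ \oo --> f x) ->
  (forall n, (\int[mu]_x (f_ n x)%:E <= B)%E) ->
  (\int[mu]_x (f x)%:E <= B)%E.
Proof.
move=> mf f0 ff fB.
have := @fatou _ _ _ mu setT measurableT (fun n x => (f_ n x)%:E).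
move=> /(_ (fun n => proj2 (measurable_EFinP _ _) (mf n))).
move=> /(_ ltac:(by move=> n x _; rewrite lee_fin)).
have -> : (\int[mu]_x limn_einf (fun n => (f_ n x)%:E) = \int[mu]_x (f x)%:E)%E.
  apply: eq_integral => x _.
  have h : (fun n => (f_ n x)%:E) @ \oo --> (f x)%:E.
    by apply: cvg_EFin (ff x); apply: nearW.
  by rewrite (cvg_limn_einf_sup h).
move/le_trans; apply; rewrite limn_einf_lim.
apply: lime_le; first exact: is_cvg_einfs.
by apply: nearW => n; apply: le_trans (fB n); apply: ereal_inf_lbound; exists n => /=.
Qed.

(** Heine's theorem on [[0, t]], for a function that is only continuous
    relatively to the half-line.  The second point may lie beyond [t]. *)
Lemma within_continuous_uniform (R : realType) (b : R -> R) (t e : R) :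
  {within `[0, +oo[, continuous b} -> 0 < e ->
  exists2 delta : R, 0 < delta & forall x y, x \in `[0, t] -> 0 <= y ->
    `|x - y| < delta -> `|b x - b y| < e.
Proof.
move=> /subspace_continuousP cb e0.
have := @segment_compact R 0 t; rewrite compact_near_coveringP => /near_covering_withinP.
move=> cover; have near0 : \forall delta \near (0:R)^'+, `[0, t]%classic `<=`
    (fun x => forall y, 0 <= y -> `|x - y| < delta -> `|b x - b y| < e).
  apply: cover.
  move=> x /=; rewrite in_itv/= => /andP[x0 xt].
  have xA : `[0, +oo[%classic x by rewrite /= in_itv/= x0.
  have /cvgrPdist_lt /(_ (e / 2) ltac:(by rewrite divr_gt0)) := cb x xA.
  rewrite near_withinE => /nbhs_ballP[r /= r0 br].
  have {}br y : 0 <= y -> `|x - y| < r -> `|b x - b y| < e / 2.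
    by move=> y0 xy; apply: br => //=; rewrite in_itv/= y0.
  exists (ball x (r / 2), [set delta | delta < r / 2]); first split => /=.
  - by apply: nbhsx_ballx; rewrite divr_gt0.
  - by apply: nbhs_right_lt; rewrite divr_gt0.
  move=> [x' delta] /= [xx' dr] /andP[x'0 _] y y0 x'y.
  have b1 : `|b x - b x'| < e / 2 by apply: br => //; apply: lt_le_trans xx' _; lra.
  have b2 : `|b x - b y| < e / 2.
    apply: br => //; rewrite (splitr r) (le_lt_trans (ler_distD x' _ _))// ltrD//.
    exact: lt_trans dr.
  rewrite (splitr e) (le_lt_trans (ler_distD (b x) _ _))// ltrD//.
  by rewrite distrC.
near ((0:R)^'+) => delta.
exists delta; first by near: delta; exact: nbhs_right_gt.
move=> x y xt y0 xy.
suff sub : `[0, t]%classic `<=` (fun x => forall y, 0 <= y -> `|x - y| < delta ->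
    `|b x - b y| < e) by exact: sub.
near: delta; exact: near0.
Unshelve. all: by end_near. Qed.

(** * Integrals against an exponential weight *)

Section ExponentialWeight.
Context (R : realType) (l t : R).
Context (l0 : 0 < l).
Local Notation mu := (@lebesgue_measure R).

Let g (s : R) : R := expR (- l * (t - s)).

Lemma is_derive_expweight (s : R) : is_derive s 1 g (l * g s).
Proof.
have d : is_derive s 1 (fun s : R => - l * (t - s)) l.
  by apply: is_derive_eq; rewrite add0r mul1r scalerN scaleNr opprK -[RHS]mulr1.
have := @is_derive1_comp _ expR (fun s : R => - l * (t - s)) s _ _ (is_derive_expR _) d.
by rewrite mulrC.
Qed.

Lemma derive1_expweight : derive1 g = (fun s => l * g s).
Proof.
apply/funext => s.
by rewrite derive1E (@derive_val _ _ _ _ _ _ _ (is_derive_expweight s)).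
Qed.

Lemma continuous_expweight : continuous g.
Proof.
move=> s; apply/differentiable_continuous/derivable1_diffP.
exact: (@ex_derive _ _ _ _ _ _ _ (is_derive_expweight s)).
Qed.

Lemma expweight_le (x y : R) : x <= y -> g x <= g y.
Proof. by move=> xy; rewrite ler_expR !mulNr lerN2 ler_pM2l// lerD2l lerN2. Qed.

Lemma Rintegral_expweight (x y : R) : x < y ->
  \int[mu]_(s in `]x, y]) (derive1 g s) = g y - g x.
Proof.
move=> xy; have cg' A : {within A, continuous (derive1 g)}.
  rewrite derive1_expweight; apply: continuous_subspaceT => s.
  by apply: cvgM; [exact: cvg_cst|exact: continuous_expweight].
have ig : mu.-integrable `[x, y] (EFin \o derive1 g).
  by apply: continuous_compact_integrable => //; exact: segment_compact.
rewrite Rintegral_itv_obnd_cbnd; last first.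
  by apply: integrableS ig => //; apply: subset_itv; rewrite bnd_simp.
rewrite /Rintegral (@continuous_FTC2 _ _ g)//.
split.
- by move=> z _; exact: (@ex_derive _ _ _ _ _ _ _ (is_derive_expweight z)).
- by apply: cvg_at_right_filter; exact: continuous_expweight.
- by apply: cvg_at_left_filter; exact: continuous_expweight.
Qed.

Context (b : R -> R).
Context (cb : {within `[0, +oo[, continuous b}).

Lemma integrable_expweightM (x y : R) : 0 <= x ->
  mu.-integrable `[x, y] (EFin \o (fun s => derive1 g s * b s)).
Proof.
move=> x0; apply: continuous_compact_integrable; first exact: segment_compact.
have cb' : {within `[x, y], continuous b}.
  by apply: continuous_subspaceW cb; apply: subset_itv; rewrite bnd_simp.
move=> s; apply: cvgM; last exact: cb'.
rewrite derive1_expweight.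
have : {within `[x, y], continuous (fun s => l * g s)}; last exact.
apply: continuous_subspaceT => z.
by apply: cvgM; [exact: cvg_cst|exact: continuous_expweight].
Qed.

Lemma Rintegral_expweight_near_cst (x y c e : R) : 0 <= x -> x < y ->
  (forall s, s \in `]x, y] -> `|b s - c| <= e) ->
  `|\int[mu]_(s in `]x, y]) (derive1 g s * b s) - (g y - g x) * c|
     <= e * (g y - g x).
Proof.
move=> x0 xy bc.
have sub : `]x, y]%classic `<=` `[x, y]%classic.
  by apply: subset_itv; rewrite bnd_simp.
have igb : mu.-integrable `]x, y] (EFin \o (fun s => derive1 g s * b s)).
  by apply: integrableS (integrable_expweightM y x0).
have ig a : mu.-integrable `]x, y] (EFin \o (fun s => derive1 g s * a)).
  suff : mu.-integrable `[x, y] (EFin \o (fun s => derive1 g s * a)).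
    by apply: integrableS.
  apply: continuous_compact_integrable; first exact: segment_compact.
  rewrite derive1_expweight; apply: continuous_subspaceT => z.
  apply: cvgM; last exact: cvg_cst.
  by apply: cvgM; [exact: cvg_cst|exact: continuous_expweight].
have ig1 : mu.-integrable `]x, y] (EFin \o derive1 g).
  by have := ig 1; congr (mu.-integrable _ (EFin \o _)); apply/funext => s; rewrite mulr1.
have cst a : \int[mu]_(s in `]x, y]) (derive1 g s * a) = (g y - g x) * a.
  by rewrite RintegralZr// Rintegral_expweight.
have g'0 s : 0 <= derive1 g s.
  by rewrite derive1_expweight mulr_ge0 ?expR_ge0 ?ltW.
have bnd s : s \in `]x, y] -> c - e <= b s <= c + e.
  by move=> /bc; rewrite ler_norml => /andP[? ?]; apply/andP; split; lra.
have lo : (g y - g x) * (c - e) <= \int[mu]_(s in `]x, y]) (derive1 g s * b s).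
  rewrite -cst; apply: le_Rintegral => // s /bnd/andP[? _].
  by rewrite ler_wpM2l.
have hi : \int[mu]_(s in `]x, y]) (derive1 g s * b s) <= (g y - g x) * (c + e).
  rewrite -cst; apply: le_Rintegral => // s /bnd/andP[_ ?].
  by rewrite ler_wpM2l.
by rewrite ler_norml; apply/andP; split; nra.
Qed.

End ExponentialWeight.

(** * Moments of one coefficient of the Ornstein-Uhlenbeck process *)

(** The first term is [u 0], so that the differences sum to [u n] and, for [u]
    nondecreasing with values in [[0, 1]], are weights; the first one plays the
    part of an atom at time [0]. *)
Definition first_diff (R : zmodType) (u : nat -> R) (j : nat) : R :=
  if j is i.+1 then u i.+1 - u i else u 0.

Lemma sum_first_diff (R : zmodType) (u : nat -> R) (n : nat) :
  \sum_(0 <= j < n.+1) first_diff u j = u n.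
Proof.
by rewrite big_nat_recl//= telescope_sumr// addrC subrK.
Qed.

(** A discrete form of [int u^q exp (- u) du <= K int exp (- u / 2) du]: [h]
    stands for [exp (- u / 2)] along a subdivision, and
    [h_j^2 - h_(j-1)^2 <= 2 h_j (h_j - h_(j-1))] makes the sum telescope. *)
Lemma sum_sqr_diff_le (R : realType) (h x : nat -> R) (K : R) (n : nat) :
  {homo h : i j / (i <= j)%N >-> i <= j} -> (forall j, 0 < h j) -> h n <= 1 ->
  (forall j, 0 <= x j <= K / h j) ->
  \sum_(0 <= j < n.+1) first_diff (fun j => h j ^+ 2) j * x j <= 2 * K.
Proof.
move=> hnd h0 hn1 xK.
have K0 : 0 <= K.
  have /andP[/le_trans + /[dup] x0K] := xK 0; move/(_ _ x0K).
  by rewrite pmulr_lge0// invr_gt0.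
apply: (@le_trans _ _ (2 * K * \sum_(0 <= j < n.+1) first_diff h j)); last first.
  by rewrite sum_first_diff ler_piMr ?mulr_ge0.
rewrite mulr_sumr; apply: ler_sum => -[|j] _ /=.
  have /andP[_] := xK 0; rewrite ler_pdivlMr// => xh.
  have -> : h 0 ^+ 2 * x 0 = h 0 * (x 0 * h 0) by ring.
  apply: le_trans (ler_wpM2l (ltW (h0 0)) xh) _.
  by have := mulr_ge0 K0 (ltW (h0 0)); lra.
have hh := hnd _ _ (leqnSn j).
have /andP[x0 xh] := xK j.+1.
have -> : (h j.+1 ^+ 2 - h j ^+ 2) * x j.+1 =
  (h j.+1 - h j) * ((h j.+1 + h j) * x j.+1) by ring.
rewrite [leRHS]mulrC ler_wpM2l ?subr_ge0//.
move: xh; rewrite ler_pdivlMr// => xh.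
by have := ler_wpM2r x0 hh; lra.
Qed.

Definition mesh (R : realType) (t : R) (n i : nat) : R := t * (i%:R / n.+1%:R).

Section Mesh.
Context (R : realType) (t : R).
Context (t0 : 0 <= t).

Lemma mesh0 n : mesh t n 0 = 0.
Proof. by rewrite /mesh mul0r mulr0. Qed.

Lemma mesh_last n : mesh t n n.+1 = t.
Proof. by rewrite /mesh divff ?mulr1// pnatr_eq0. Qed.

Lemma mesh_ge0 n i : 0 <= mesh t n i.
Proof. by rewrite /mesh mulr_ge0// divr_ge0. Qed.

Lemma mesh_le n i j : (i <= j)%N -> mesh t n i <= mesh t n j.
Proof. by move=> ij; rewrite /mesh ler_wpM2l// ler_wpM2r ?invr_ge0// ler_nat. Qed.

Lemma mesh_le_last n i : (i <= n.+1)%N -> mesh t n i <= t.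
Proof. by move=> /(mesh_le n); rewrite mesh_last. Qed.

Lemma mesh_step n i : mesh t n i.+1 - mesh t n i = t / n.+1%:R.
Proof. by rewrite /mesh -natr1; ring. Qed.

End Mesh.

Section RiemannSums.
Context (R : realType) (l t : R) (b : R -> R).
Context (l0 : 0 < l).
Context (t0 : 0 <= t).
Context (cb : {within `[0, +oo[, continuous b}).
Local Notation mu := (@lebesgue_measure R).
Let g (s : R) : R := expR (- l * (t - s)).

(** On each interval of a fine subdivision [b] is almost constant, and the
    masses that [derive1 g] gives to these intervals are exactly the increments
    of [g], so the errors add up to at most [e (g t - g 0) <= e]. *)
Lemma cvg_riemann_sum_expweight :
  \sum_(0 <= i < n.+1)
     (g (mesh t n i.+1) - g (mesh t n i)) * b (mesh t n i.+1) @[n --> \oo]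
  --> \int[mu]_(s in `[0, t]) (derive1 g s * b s).
Proof.
move: (t0); rewrite le_eqVlt => /predU1P[t00|tgt0].
  rewrite -t00 set_itv1 Rintegral_set1.
  apply: cvg_near_cst; apply: nearW => n; rewrite big1// => i _.
  by rewrite /mesh !mul0r subrr mul0r.
apply/cvgrPdist_le => e e0.
have [delta d0 bd] := within_continuous_uniform t cb e0.
near=> n.
have nd : t / n.+1%:R < delta.
  rewrite ltr_pdivrMr// mulrC -ltr_pdivrMr//.
  apply: (@lt_trans _ _ n%:R); last by rewrite ltr_nat.
  by near: n; exact: nbhs_infty_gtr.
pose F x := \int[mu]_(s in `[0, x]) (derive1 g s * b s).
have -> : \int[mu]_(s in `[0, t]) (derive1 g s * b s) =
    \sum_(0 <= i < n.+1) (F (mesh t n i.+1) - F (mesh t n i)).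
  rewrite telescope_sumr// mesh_last mesh0 /F set_itv1 Rintegral_set1 subr0//.
rewrite -sumrB; apply: le_trans (ler_norm_sum _ _ _) _.
apply: (@le_trans _ _ (\sum_(0 <= i < n.+1)
    e * (g (mesh t n i.+1) - g (mesh t n i)))); last first.
  rewrite -mulr_sumr telescope_sumr// mesh_last mesh0 ler_piMr ?(ltW e0)//.
  by rewrite /g subrr mulr0 expR0 lerBlDr lerDl expR_ge0.
rewrite !big_nat; apply: ler_sum => i /andP[_ i_n].
set x := mesh t n i; set y := mesh t n i.+1.
have xy : x < y by rewrite -subr_gt0 mesh_step divr_gt0.
have x0 : 0 <= x by exact: mesh_ge0.
have -> : F y - F x = \int[mu]_(s in `]x, y]) (derive1 g s * b s).
  rewrite /F Rintegral_itvB//.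
  - exact: integrable_expweightM.
  - by rewrite bnd_simp ltW.
apply: Rintegral_expweight_near_cst => // s; rewrite in_itv/= => /andP[xs sy].
have y0 : 0 <= y by exact: mesh_ge0.
have s0 : 0 <= s by rewrite (le_trans x0)// ltW.
apply/ltW/bd => //.
  by rewrite in_itv/= s0/= (le_trans sy)// mesh_le_last.
rewrite distrC ger0_norm ?subr_ge0// (le_lt_trans _ nd)//.
rewrite -(mesh_step t n i) lerB// ltW//.
Unshelve. all: by end_near. Qed.

(** The average of [b t - b s] for a discretisation of the probability measure
    with density [derive1 g] on [[0, t]] and an atom [g 0] at [0].  At the atom
    the value is [b t] and not [b t - b 0], which keeps the limit below exact
    for every [b]. *)
Definition increment_average (n : nat) : R :=
  \sum_(0 <= j < n.+2) first_diff (g \o mesh t n) j *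
    (if j is i.+1 then b t - b (mesh t n j) else b t).

Lemma cvg_increment_average :
  increment_average n @[n --> \oo] --> path_integral g b t.
Proof.
rewrite /path_integral.
have -> : g t = 1 by rewrite /g subrr mulr0 expR0.
rewrite mul1r; apply: cvg_trans (cvgB (cvg_cst (b t)) cvg_riemann_sum_expweight).
apply: near_eq_cvg; apply: nearW => n.
rewrite /increment_average big_nat_recl//=.
under [in RHS]eq_bigr do rewrite mulrBr.
rewrite sumrB -mulr_suml telescope_sumr// mesh_last mesh0 addrA; congr (_ - _).
by rewrite -mulrDl addrC subrK /g subrr mulr0 expR0 mul1r.
Qed.

End RiemannSums.

(** The discretised averages of increments obey the bound by Jensen's
    inequality, and Fatou's lemma carries it to the limit.  The increments
    are taken at right endpoints, where [t - s] is smallest on each interval,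
    so that the sums over the subdivision stay below a bound that does not
    depend on it. *)
Lemma fOU_moment_le (R : realType) (p : nat) (H : R) : (0 < p)%N -> 0 < H ->
  exists2 C : R, 0 <= C &
    forall d (T : measurableType d) (P : probability T R) (X : R -> T -> R) (l t : R),
      fractional_brownian_motion P H X -> 0 < l -> 0 <= t ->
      let Z w := path_integral (fun s => expR (- l * (t - s))) (X ^~ w) t in
      measurable_fun setT Z /\
      (\int[P]_w (Z w ^+ (2 * p))%:E <= (C * (l `^ (- (2 * H))) ^+ p)%:E)%E.
Proof.
move=> p0 H0; have [C C0 HC] := fbm_increment_moment_le R p0.
pose q : R := 2 * H * p%:R.
have q0 : 0 < q by rewrite !mulr_gt0// ltr0n.
have [K K0 HK] := @powR_le_expR R q 2^-1 q0 ltac:(by rewrite invr_gt0).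
exists (C * (2 * K)); first by rewrite !mulr_ge0.
move=> d T P X l t fX l0 t0 Z.
have cX w : {within `[0, +oo[, continuous (X ^~ w)} by have [_ _ _] := fX.
pose g (s : R) : R := expR (- l * (t - s)).
pose Y n j w := if j is i.+1 then X t w - X (mesh t n j) w else X t w.
pose A n w := increment_average l t (X ^~ w) n.
have AE n w : A n w = \sum_(0 <= j < n.+2) first_diff (g \o mesh t n) j * Y n j w.
  by apply: eq_bigr => -[].
have AZ w : A n w @[n --> \oo] --> Z w by exact: cvg_increment_average.
have mX s : 0 <= s -> measurable_fun setT (X s) by apply: fbm_measurable fX _.
have mY n j : measurable_fun setT (Y n j).
  case: j => [|j]; first exact: mX.
  by apply: measurable_funB; apply: mX => //; exact: mesh_ge0.
have mA n : measurable_fun setT (A n).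
  rewrite (_ : A n = fun w => \sum_(0 <= j < n.+2)
      first_diff (g \o mesh t n) j * Y n j w); last first.
    by apply/funext => w; exact: AE.
  by apply: measurable_sum => j; apply: measurable_funM.
have mZ : measurable_fun setT Z by apply: (measurable_fun_cvg mA) => w _; exact: AZ.
split => //.
have ev (z : R) : 0 <= z ^+ (2 * p) by rewrite exprM exprn_ge0// sqr_ge0.
apply: (@integral_lim_le _ _ _ _ (fun n w => A n w ^+ (2 * p))).
- by move=> n; apply: measurable_funX.
- by [].
- move=> w.
  apply: (@continuous_cvg _ _ _ _ _ (A ^~ w) (fun x : R => x ^+ (2 * p))).
    exact: exprn_continuous.
  exact: AZ.
move=> n; set w_ := first_diff (g \o mesh t n).
have w0 j : 0 <= w_ j.
  case: j => [|j]; first exact: expR_ge0.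
  by rewrite /w_/= subr_ge0 expweight_le// mesh_le.
apply: (@le_trans _ _ (\int[P]_w
  (\sum_(0 <= j < n.+2) (w_ j)%:E * (Y n j w ^+ (2 * p))%:E))%E).
  apply: ge0_le_integral => //.
  - by move=> w _; rewrite lee_fin.
  - by apply/measurable_EFinP; apply: measurable_funX.
  - apply: emeasurable_sum => j; apply: emeasurable_funM => //.
    by apply/measurable_EFinP; apply: measurable_funX.
  move=> w _; under eq_bigr do rewrite -EFinM.
  rewrite sumEFin lee_fin AE jensen_expr_even//.
  by rewrite sum_first_diff /= mesh_last /g subrr mulr0 expR0.
rewrite ge0_integral_sum//; last 2 first.
- move=> j; apply: emeasurable_funM => //.
  by apply/measurable_EFinP; apply: measurable_funX.
- by move=> j w _; rewrite mule_ge0// lee_fin.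
(* [u j] is negative beyond the last point of the mesh, so [u j `^ q] is
   replaced by [0] there *)
pose u j := l * (t - mesh t n j).
pose h j := expR (- (2^-1 * u j)).
pose uq j := if (j <= n.+1)%N then u j `^ q else 0.
apply: (@le_trans _ _ (\sum_(0 <= j < n.+2)
  (w_ j * (C * (l `^ (- (2 * H))) ^+ p * uq j))%:E)%E).
  rewrite !big_nat; apply: lee_sum => j /andP[_ jn].
  rewrite ge0_integralZl//; last 3 first.
  - by apply/measurable_EFinP; apply: measurable_funX.
  - by move=> w _; rewrite lee_fin.
  - by rewrite lee_fin.
  rewrite EFinM lee_wpmul2l ?lee_fin// /uq -ltnS jn.
  have tm : 0 <= t - mesh t n j by rewrite subr_ge0 mesh_le_last.
  have -> : C * l `^ (- (2 * H)) ^+ p * u j `^ q = C * ((t - mesh t n j) `^ (2 * H)) ^+ p.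
    rewrite -mulrA; congr (_ * _); rewrite /q powRrM powR_mulrn ?powR_ge0//.
    rewrite -exprMn /u powRM ?(ltW l0)// mulrA powRN mulVf ?mul1r//.
    by rewrite gt_eqF// powR_gt0.
  case: j jn tm => [|j] jn tm.
    by rewrite mesh0 subr0; have [] := HC _ _ P H X H0 fX t t t0 t0.
  have [_] := HC _ _ P H X H0 fX t (mesh t n j.+1) t0 (mesh_ge0 t0 _ _).
  by rewrite (ger0_norm tm).
rewrite sumEFin lee_fin.
have -> : \sum_(0 <= j < n.+2) w_ j * (C * (l `^ (- (2 * H))) ^+ p * uq j) =
    C * (l `^ (- (2 * H))) ^+ p *
      \sum_(0 <= j < n.+2) first_diff (fun j => h j ^+ 2) j * uq j.
  rewrite mulr_sumr; apply: eq_bigr => j _; rewrite mulrCA; congr (_ * (_ * _)).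
  have hg i : h i ^+ 2 = g (mesh t n i).
    by rewrite /h -expRM_natl /g /u; congr expR; field.
  by case: j => [|j]; rewrite /w_/= !hg.
rewrite [leRHS]mulrAC ler_wpM2l ?mulr_ge0 ?exprn_ge0 ?powR_ge0//.
apply: sum_sqr_diff_le => [i j ij|j||j].
- by rewrite ler_expR lerN2 /u !ler_pM2l// ?invr_gt0// lerD2l lerN2 mesh_le.
- exact: expR_gt0.
- by rewrite /h /u mesh_last subrr !mulr0 oppr0 expR0.
- rewrite /uq; case: ifPn => [jn|_]; last by rewrite lexx divr_ge0// expR_ge0.
  rewrite powR_ge0/= /h expRN invrK HK// mulr_ge0 ?(ltW l0)//.
  by rewrite subr_ge0 mesh_le_last.
Qed.

(** * Completeness of the space of square-integrable functions *)
Lemma nneseries_le (R : realType) (a : nat -> R) (m : nat) (B : R) :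
  (forall k, 0 <= a k) -> (forall n, \sum_(m <= k < n) a k <= B) ->
  (\sum_(m <= k <oo) (a k)%:E <= B%:E)%E.
Proof.
move=> a0 aB; apply: lime_le.
  by apply: is_cvg_nneseries => k _ _; rewrite lee_fin.
by apply: nearW => n; rewrite sumEFin lee_fin.
Qed.

Lemma sum_half_le (R : realType) (n : nat) : \sum_(0 <= j < n) (2^-1 : R) ^+ j <= 2.
Proof.
suff -> : \sum_(0 <= j < n) (2^-1 : R) ^+ j = 2 - 2 * 2^-1 ^+ n.
  by rewrite lerBlDr lerDl mulr_ge0// exprn_ge0.
elim: n => [|n IH]; first by rewrite big_geq// expr0 mulr1 subrr.
by rewrite big_nat_recr//= IH exprS; field.
Qed.

Section L2Completeness.
Context d (T : measurableType d) (R : realType).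
Context (mu : {measure set T -> \bar R}) (u : nat -> T -> R).
Context (mu_ : forall n, measurable_fun setT (u n)).
Context (cauchy_u : forall e : R, 0 < e -> exists N, forall m n,
  (N <= m)%N -> (N <= n)%N ->
  (\int[mu]_x ((u m x - u n x) ^+ 2)%:E <= e%:E)%E).

Let msq m n : measurable_fun setT (fun x => ((u m x - u n x) ^+ 2)%:E).
Proof. by apply/measurable_EFinP; apply: measurable_funX; exact: measurable_funB. Qed.

(** The growth [j <= k j] is what lets the Cauchy property apply to [u (k j)]
    for large [j]. *)
Lemma fast_subsequence : exists k : nat -> nat, (forall j, (j <= k j)%N) /\
  forall j, (\int[mu]_x ((u (k j.+1) x - u (k j) x) ^+ 2)%:E <= ((4^-1) ^+ j)%:E)%E.
Proof.
have /choice[N HN] : forall j : nat, exists N, forall m n, (N <= m)%N -> (N <= n)%N ->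
    (\int[mu]_x ((u m x - u n x) ^+ 2)%:E <= ((4^-1 : R) ^+ j)%:E)%E.
  by move=> j; apply: cauchy_u; rewrite exprn_gt0// invr_gt0.
exists (fun j => \sum_(0 <= i < j.+1) (N i).+1)%N; split.
  elim=> [//|j IH]; rewrite big_nat_recr//=.
  by rewrite (leq_ltn_trans IH)// -[ltnLHS]addn0 ltn_add2l.
move=> j; apply: HN; rewrite big_nat_recr//=.
  rewrite big_nat_recr//=.
  by rewrite -addnA addnC -addnA addSn (leq_trans (leq_addr _ _) (leqnSn _)).
by rewrite addnC addSn (leq_trans (leq_addr _ _) (leqnSn _)).
Qed.

(** The series [sum_j 2^j v_j^2] of weighted squares of the successive
    differences has a finite integral, since [int v_j^2 <= 4^(- j)]; where it
    is finite, [2 |v_j| <= 2^(- j) + 2^j v_j^2] makes the differences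
    absolutely summable. *)
Lemma ae_cvg_subsequence (k : nat -> nat) :
  (forall j, (\int[mu]_x ((u (k j.+1) x - u (k j) x) ^+ 2)%:E <= ((4^-1) ^+ j)%:E)%E) ->
  {ae mu, forall x, cvgn (fun j => u (k j) x)}.
Proof.
move=> Hk; pose v j x := u (k j.+1) x - u (k j) x.
pose G x := (\sum_(0 <= j <oo) (2 ^+ j * v j x ^+ 2)%:E)%E.
have t0 j x : (0 <= (2 ^+ j * v j x ^+ 2)%:E)%E.
  by rewrite lee_fin mulr_ge0 ?sqr_ge0// exprn_ge0.
have mv j : measurable_fun setT (fun x => (2 ^+ j * v j x ^+ 2)%:E).
  apply/measurable_EFinP; apply: measurable_funM => //.
  by apply: measurable_funX; exact: measurable_funB.
have mG : measurable_fun setT G.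
  by apply: ge0_emeasurable_sum.
have G0 x : (0 <= G x)%E by apply: nneseries_ge0.
have iG : mu.-integrable setT G.
  apply/integrableP; split => //.
  under eq_integral => x _ do rewrite gee0_abs//.
  rewrite integral_nneseries//.
  apply: (@le_lt_trans _ _ (\sum_(0 <= j <oo) (2^-1 ^+ j)%:E)%E).
    apply: lee_nneseries => [j _ _|j _]; first by apply: integral_ge0.
    under eq_integral do rewrite EFinM.
    rewrite ge0_integralZl//; try exact: msq.
      2: by move=> x _; rewrite lee_fin sqr_ge0.
    apply: (le_trans (lee_wpmul2l _ (Hk j))); first by rewrite lee_fin exprn_ge0.
    rewrite -EFinM lee_fin -exprMn.
    by have -> : 2 * 4^-1 = 2^-1 :> R by field.
  apply: (@le_lt_trans _ _ 2%:E); last exact: ltry.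
  by apply: nneseries_le (@sum_half_le R) => j; rewrite exprn_ge0.
have := integrable_ae measurableT iG; apply: filterS => x /(_ I) Gx.
have [D GD] : exists D, G x = D%:E by exists (fine (G x)); rewrite fineK.
suff sv : cvgn (series (v ^~ x)).
  have -> : (fun j => u (k j) x) = (fun j => u (k 0) x + series (v ^~ x) j).
    by apply/funext => j; rewrite /series/= telescope_sumr// addrC subrK.
  by apply: is_cvgD => //; exact: is_cvg_cst.
apply: normed_cvg; apply: nondecreasing_is_cvgn.
  by apply: nondecreasing_series => ? _ _ /=.
exists (2 + D) => _ [n _ <-].
(* the difference of the two sides is at least 2^-j (1 - 2^j |z|)^2 *)
apply: (@le_trans _ _ (\sum_(0 <= j < n) (2^-1 ^+ j + 2 ^+ j * v j x ^+ 2))).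
  apply: ler_sum => j _; set z := v j x.
  have c0 : 0 < 2 ^+ j :> R by rewrite exprn_gt0.
  rewrite exprVn -(real_normK (num_real z)).
  have : 0 <= (2 ^+ j)^-1 * (1 - 2 ^+ j * `|z|) ^+ 2.
    by rewrite mulr_ge0 ?sqr_ge0// invr_ge0 ltW.
  have -> : (2 ^+ j)^-1 * (1 - 2 ^+ j * `|z|) ^+ 2 =
     (2 ^+ j)^-1 + 2 ^+ j * `|z| ^+ 2 - 2 * `|z| by field; rewrite gt_eqF.
  by rewrite /= -/z; have := normr_ge0 z; lra.
rewrite big_split/= lerD ?sum_half_le//.
by rewrite -lee_fin -GD -sumEFin; apply: nneseries_lim_ge.
Qed.

(** The limit is taken along an almost everywhere convergent subsequence, as
    [limn_esup] to have measurability everywhere; Fatou's lemma then turns the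
    Cauchy property into convergence of the whole sequence. *)
Lemma L2_complete : exists2 f : T -> R, measurable_fun setT f &
  forall e : R, 0 < e -> exists N, forall n, (N <= n)%N ->
    (\int[mu]_x ((f x - u n x) ^+ 2)%:E <= e%:E)%E.
Proof.
have [k [kj Hk]] := fast_subsequence.
have ae_cvg := ae_cvg_subsequence Hk.
pose F x := limn_esup (fun j => (u (k j) x)%:E).
have mF : measurable_fun setT F.
  by apply: measurable_fun_limn_esup => j; apply/measurable_EFinP.
pose f x := fine (F x).
have mf : measurable_fun setT f by exact: measurableT_comp.
have fE x : cvgn (fun j => u (k j) x) -> u (k j) x @[j --> \oo] --> f x.
  move=> cu; have cuE : (u (k j) x)%:E @[j --> \oo] --> (limn (fun j => u (k j) x))%:E.
    by apply: cvg_EFin => //; apply: nearW.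
  by rewrite /f /F (cvg_limn_einf_sup cuE).
exists f => // e e0; have [N HN] := cauchy_u e0; exists N => n Nn.
have := @fatou _ _ _ mu setT measurableT (fun j x => ((u (k j) x - u n x) ^+ 2)%:E).
move=> /(_ (fun j => msq _ _)) /(_ ltac:(by move=> j x _; rewrite lee_fin sqr_ge0)).
have <- : (\int[mu]_x ((f x - u n x) ^+ 2)%:E =
    \int[mu]_x limn_einf (fun j => ((u (k j) x - u n x) ^+ 2)%:E))%E.
  apply: ae_eq_integral => //.
  - by apply/measurable_EFinP; apply: measurable_funX; exact: measurable_funB.
  - rewrite (_ : (fun x => _) = fun x =>
        (- limn_esup (-%E \o (fun j => ((u (k j) x - u n x) ^+ 2)%:E)))%E); last first.
      by apply/funext => x; rewrite limn_esupN oppeK.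
    apply: measurableT_comp => //; apply: measurable_fun_limn_esup => j.
    by apply: measurableT_comp => //; exact: msq.
  apply: filterS ae_cvg => x /fE ux _.
  have h : (fun j => ((u (k j) x - u n x) ^+ 2)%:E) @ \oo --> ((f x - u n x) ^+ 2)%:E.
    apply: cvg_EFin; first exact: nearW.
    apply: (@continuous_cvg _ _ _ _ _ _ (fun z : R => z ^+ 2)).
      exact: exprn_continuous.
    by apply: cvgB => //; exact: cvg_cst.
  by rewrite (cvg_limn_einf_sup h).
move=> /le_trans; apply; rewrite limn_einf_lim.
apply: lime_le; first exact: is_cvg_einfs.
apply: nearW => j; apply: le_trans (HN (k (maxn N j)) n _ Nn); last first.
  exact: leq_trans (leq_maxl _ _) (kj _).
by apply: ereal_inf_lbound; exists (maxn N j) => //=; exact: leq_maxr.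
Qed.
End L2Completeness.

(** * Orthonormality of the sine functions on the unit interval *)

Section Lebesgue01.
Context (R : realType).
Local Notation mu := (@lebesgue_measure R).
Local Notation mu01 := (@lebesgue01 R).

(** The restricted measure does not charge the complement of the interval and
    agrees with Lebesgue measure inside it. *)
Lemma ge0_integral_lebesgue01 (f : measurableTypeR R -> \bar R) :
  measurable_fun setT f -> (forall x, 0 <= f x)%E ->
  (\int[mu01]_x f x = \int[mu]_(x in `]0%R, 1%R[) f x)%E.
Proof.
move=> mf f0; pose D : set (measurableTypeR R) := `]0%R, 1%R[%classic.
have mD : measurable D by exact: measurable_itv.
rewrite (@ge0_negligible_integral _ _ _ _ setT (~` D))//.
- rewrite setTD setCK; apply: eq_measure_integral => A mA A01.
  by rewrite /= /mrestr setIidl.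
- exact: measurableC.
- by change (mu (~` D `&` D) = 0%E); rewrite setICl measure0.
Qed.

Lemma integral_lebesgue01 (f : measurableTypeR R -> \bar R) :
  measurable_fun setT f ->
  (\int[mu01]_x f x = \int[mu]_(x in `]0%R, 1%R[) f x)%E.
Proof.
move=> mf; rewrite integralE [RHS]integralE; congr (_ - _)%E.
  by apply: ge0_integral_lebesgue01 => //; exact: measurable_funepos.
by apply: ge0_integral_lebesgue01 => //; exact: measurable_funeneg.
Qed.

Lemma continuous_integrable_itv (f : R -> R) : continuous f ->
  mu.-integrable `[0, 1] (EFin \o f).
Proof.
move=> cf; apply: continuous_compact_integrable; first exact: segment_compact.
exact: continuous_subspaceT.
Qed.

Lemma continuous_integrable01 (f : R -> R) : continuous f ->
  mu01.-integrable setT (EFin \o f).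
Proof.
move=> cf; have mf : measurable_fun setT f by exact: continuous_measurable_fun.
apply/integrableP; split; first exact/measurable_EFinP.
have mF : measurable_fun [set: measurableTypeR R] (fun x => `|(EFin \o f) x|%E).
  by apply: measurableT_comp => //; exact/measurable_EFinP.
rewrite ge0_integral_lebesgue01//.
have /integrableP[_] : mu.-integrable `]0%R, 1%R[ (EFin \o f).
  apply: integrableS (continuous_integrable_itv cf) => //.
  by apply: subset_itv; rewrite bnd_simp.
by [].
Qed.

Lemma Rintegral_lebesgue01 (f : R -> R) : continuous f ->
  \int[mu01]_x f x = \int[mu]_(x in `[0, 1]) f x.
Proof.
move=> cf; have mf : measurable_fun setT f by exact: continuous_measurable_fun.
rewrite /Rintegral integral_lebesgue01; last exact/measurable_EFinP.
congr fine; rewrite [RHS]integral_itv_bndoo//; apply/measurable_EFinP.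
exact: measurable_funTS.
Qed.

Lemma sin_natpi (n : nat) : sin (n%:R * pi) = 0 :> R.
Proof.
elim: n => [|n IH]; first by rewrite mul0r sin0.
by rewrite -natr1 mulrDl mul1r sinDpi IH oppr0.
Qed.

Lemma continuous_cosM (c : R) : continuous (fun u : R => cos (c * u)).
Proof.
move=> u; apply: continuous_comp; last exact: continuous_cos.
by apply: cvgM; [exact: cvg_cst|exact: cvg_id].
Qed.

Lemma Rintegral_cosM (c : R) : c != 0 ->
  \int[mu]_(u in `[0, 1]) cos (c * u) = sin c / c.
Proof.
move=> c0.
have d (u : R) : is_derive u 1 (fun u => c^-1 * sin (c * u)) (cos (c * u)).
  have d1 : is_derive u 1 (fun u : R => c * u) c.
    by apply: is_derive_eq; rewrite [_ *: _]mulr1.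
  have d2 := @is_derive1_comp _ sin (fun u : R => c * u) u _ _ (is_derive_sin _) d1.
  have := @is_deriveZ _ _ _ _ c^-1 _ _ _ d2.
  suff -> : c^-1 *: (cos (c * u) * c) = cos (c * u) by [].
  by rewrite [LHS]mulrCA mulVf// mulr1.
have dc u : {for u, continuous (fun u : R => c^-1 * sin (c * u))}.
  apply/differentiable_continuous/derivable1_diffP.
  exact: (@ex_derive _ _ _ _ _ _ _ (d u)).
rewrite /Rintegral (@continuous_FTC2 _ _ (fun u => c^-1 * sin (c * u)))//.
- by rewrite /= !mulr0 sin0 mulr1 mulr0 subr0 mulrC.
- by apply: continuous_subspaceT; exact: continuous_cosM.
- split.
  + by move=> z _; exact: (@ex_derive _ _ _ _ _ _ _ (d z)).
  + by apply: cvg_at_right_filter; exact: dc.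
  + by apply: cvg_at_left_filter; exact: dc.
- by move=> z _; rewrite derive1E (@derive_val _ _ _ _ _ _ _ (d z)).
Qed.

Lemma continuous_eigenfun (k : nat) : continuous (@dirichlet_eigenfun R k).
Proof.
move=> u; apply: cvgM; first exact: cvg_cst.
apply: continuous_comp; last exact: continuous_sin.
by apply: cvgM; [exact: cvg_cst|exact: cvg_id].
Qed.

Lemma continuousM_fun (f g : R -> R) : continuous f -> continuous g ->
  continuous (fun u => f u * g u).
Proof. by move=> cf cg u; apply: cvgM; [exact: cf|exact: cg]. Qed.

(** Product to sum: [2 sin a sin b = cos (a - b) - cos (a + b)]. *)
Lemma L2_inner_eigenfun (j k : nat) : (1 <= j)%N -> (1 <= k)%N ->
  L2_inner (@dirichlet_eigenfun R j) (@dirichlet_eigenfun R k) = (j == k)%:R.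
Proof.
move=> j1 k1; rewrite /L2_inner Rintegral_lebesgue01; last first.
  by apply: continuousM_fun; exact: continuous_eigenfun.
transitivity (\int[mu]_(u in `[0, 1])
    (cos ((j%:R - k%:R) * pi * u) - cos ((j%:R + k%:R) * pi * u))).
  apply: eq_Rintegral => u _; rewrite /dirichlet_eigenfun.
  rewrite !(mulrBl, mulrDl) cosB cosD.
  have := @sqr_sqrtr R 2 ltac:(by []); rewrite expr2 => s2.
  by rewrite mulrACA s2; ring.
rewrite RintegralB//; [|exact/continuous_integrable_itv/continuous_cosM|
  exact/continuous_integrable_itv/continuous_cosM].
have pi0 : pi != 0 :> R by rewrite gt_eqF// pi_gt0.
have jk0 : (j%:R + k%:R) * pi != 0 :> R.
  by rewrite mulf_neq0// -natrD pnatr_eq0 -lt0n addn_gt0 j1.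
rewrite (Rintegral_cosM jk0) -natrD sin_natpi mul0r subr0.
have [<-|jk] := eqVneq j k.
  under eq_Rintegral do rewrite subrr !mul0r cos0.
  rewrite Rintegral_cst//= lebesgue_measure_itv/= lte_fin ltr01.
  by rewrite -EFinB/= subr0 mulr1.
rewrite Rintegral_cosM; last by rewrite mulf_neq0// subr_eq0 eqr_nat.
by rewrite mulrBl sinB !sin_natpi !(mul0r, mulr0) subrr mul0r.
Qed.

(** Two bounds, so that differences of partial sums have the same form. *)
Definition sine_sum (c : nat -> R) (m n : nat) (u : R) : R :=
  \sum_(m <= k < n) c k * dirichlet_eigenfun k u.

Lemma continuous_sine_sum c m n : continuous (sine_sum c m n).
Proof.
rewrite (_ : sine_sum c m n = fun u =>
  \sum_(k <- index_iota m n) c k * dirichlet_eigenfun k u)//.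
elim: (index_iota m n) => [|k s IH] u.
  rewrite (_ : (fun u => _) = cst 0); first exact: cvg_cst.
  by apply/funext => v; rewrite big_nil.
rewrite (_ : (fun u => _) = fun u => c k * dirichlet_eigenfun k u +
  \sum_(k <- s) c k * dirichlet_eigenfun k u); last first.
  by apply/funext => v; rewrite big_cons.
apply: cvgD; last exact: IH.
by apply: cvgM; [exact: cvg_cst|exact: continuous_eigenfun].
Qed.

Lemma L2_inner_sine_sum (c : nat -> R) (m n : nat) (f : R -> R) : continuous f ->
  L2_inner (sine_sum c m n) f =
  \sum_(m <= k < n) c k * L2_inner (@dirichlet_eigenfun R k) f.
Proof.
move=> cf; have [mn|nm] := leqP m n; last first.
  rewrite big_geq 1?ltnW// /L2_inner /sine_sum.
  under eq_Rintegral do rewrite big_geq 1?ltnW// mul0r.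
  by rewrite Rintegral_cst// mul0r.
elim: n mn => [|n IH].
  rewrite leqn0 => /eqP->; rewrite big_geq// /L2_inner /sine_sum.
  under eq_Rintegral do rewrite big_geq// mul0r.
  by rewrite Rintegral_cst// mul0r.
rewrite leq_eqVlt => /predU1P[<-|]; last rewrite ltnS => mn.
  rewrite big_geq// /L2_inner /sine_sum.
  under eq_Rintegral do rewrite big_geq// mul0r.
  by rewrite Rintegral_cst// mul0r.
rewrite big_nat_recr//= -IH// /L2_inner.
under eq_Rintegral do rewrite /sine_sum big_nat_recr//= mulrDl -mulrA.
have cef : continuous (fun u => dirichlet_eigenfun n u * f u).
  by apply: continuousM_fun => //; exact: continuous_eigenfun.
rewrite RintegralD//; last 2 first.
- apply: continuous_integrable01; apply: continuousM_fun => //.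
  exact: continuous_sine_sum.
- by apply: continuous_integrable01 => u; apply: cvgM; [exact: cvg_cst|exact: cef].
by rewrite RintegralZl//; exact: continuous_integrable01.
Qed.

Lemma L2_innerC (f g : R -> R) : L2_inner f g = L2_inner g f.
Proof. by apply: eq_Rintegral => u _; rewrite mulrC. Qed.

Lemma L2_inner_sine_sum_eigenfun (c : nat -> R) (n k : nat) :
  (1 <= k < n)%N -> L2_inner (sine_sum c 1 n) (@dirichlet_eigenfun R k) = c k.
Proof.
move=> /andP[k1 kn]; rewrite L2_inner_sine_sum; last exact: continuous_eigenfun.
rewrite (bigD1_seq k) ?mem_index_iota ?k1 ?iota_uniq//=.
rewrite L2_inner_eigenfun// eqxx mulr1 big_seq_cond big1 ?addr0// => i.
rewrite mem_index_iota => /andP[/andP[i1 _] ik].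
by rewrite L2_inner_eigenfun// (negbTE ik) mulr0.
Qed.

(** Parseval's identity for finite sine sums. *)
Lemma integral_sine_sum_sqr (c : nat -> R) (m n : nat) : (1 <= m)%N ->
  (\int[mu01]_u (sine_sum c m n u ^+ 2)%:E = (\sum_(m <= k < n) c k ^+ 2)%:E)%E.
Proof.
move=> m1.
have cs : continuous (sine_sum c m n) by exact: continuous_sine_sum.
have -> : \sum_(m <= k < n) c k ^+ 2 = L2_inner (sine_sum c m n) (sine_sum c m n).
  rewrite L2_inner_sine_sum// !big_nat; apply: eq_bigr => k /andP[mk kn].
  rewrite L2_innerC L2_inner_sine_sum; last exact: continuous_eigenfun.
  rewrite (bigD1_seq k) ?mem_index_iota ?mk ?iota_uniq//=.
  rewrite L2_inner_eigenfun ?(leq_trans m1)// eqxx mulr1 big_seq_cond big1 ?addr0// => i.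
  rewrite mem_index_iota => /andP[/andP[mi _] ik].
  by rewrite L2_inner_eigenfun ?(leq_trans m1)// (negbTE ik) mulr0.
rewrite /L2_inner /Rintegral fineK.
  by apply: eq_integral => u _; rewrite expr2.
apply: integrable_fin_num => //; apply: continuous_integrable01.
exact: continuousM_fun.
Qed.

End Lebesgue01.

(** * Convergence of formal sums *)

Section L2Space.
Context (R : realType).
Local Notation mu01 := (@lebesgue01 R).

Lemma L2_normE (f : R -> R) :
  L2_norm f = ((\int[mu01]_u (f u ^+ 2)%:E) `^ 2^-1)%E.
Proof.
rewrite /L2_norm unlock; congr (_ `^ _)%E; apply: eq_integral => u _ /=.
by rewrite -[2]/(2%:R) powR_mulrn// real_normK// num_real.
Qed.

Lemma L2_norm_ae (f g : R -> R) :
  measurable_fun setT f -> measurable_fun setT g ->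
  {ae mu01, forall u, f u = g u} -> L2_norm f = L2_norm g.
Proof.
move=> mf mg fg; rewrite !L2_normE; congr (_ `^ _)%E.
apply: ae_eq_integral => //.
- by apply/measurable_EFinP; exact: measurable_funX.
- by apply/measurable_EFinP; exact: measurable_funX.
- case: fg => N [mN N0 sN]; exists N; split => // u /= nu.
  by apply: sN => /= fgu; apply: nu => _; rewrite fgu.
Qed.

Lemma measurable_L2 (x : L2_01 R) : measurable_fun setT (x : R -> R).
Proof.
exact: (measurable_funPT
  (repr (x : {mfun_ mu01, measurableTypeR R >-> measurableTypeR R}))).
Qed.

(** An element of the space is a class modulo almost everywhere equality, read
    as a function through a chosen representative; hence equality with [f]
    holds only almost everywhere. *)
Lemma L2_space_of_fun (f : R -> R) : measurable_fun setT f ->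
  (L2_norm f < +oo)%E -> exists x : L2_01 R, {ae mu01, forall u, x u = f u}.
Proof.
move=> mf nf.
pose fm : {mfun (measurableTypeR R) >-> (measurableTypeR R)} :=
  mfun_Sub (mem_set mf : (f : measurableTypeR R -> measurableTypeR R) \in mfun).
pose x0 : {mfun_ mu01, measurableTypeR R >-> measurableTypeR R} :=
  (\pi_({mfun_ mu01, measurableTypeR R >-> measurableTypeR R}) fm)%qT.
have xf : {ae mu01, forall u, x0 u = f u}.
  have : (repr x0 == fm %[mod {mfun_ mu01, measurableTypeR R >-> measurableTypeR R}])%qT.
    by rewrite reprK.
  rewrite eqmodE => /asboolP [N [mN N0 sN]].
  exists N; split => // u /= nu; apply: sN => /= fgu; apply: nu.
  exact: fgu.
have mx0 : measurable_fun setT (x0 : R -> R) by exact: (measurable_funPT (repr x0)).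
have fin : finite_norm mu01 2%:E x0.
  by rewrite /finite_norm -/(L2_norm x0) (L2_norm_ae mx0 mf xf).
pose cls := isFinLebesgue.Build _ _ _ mu01 _ (lee1n 2) x0 fin.
pose x : L2_01 R := HB.pack x0 cls.
by exists x.
Qed.

Lemma poweR_half_le (a : \bar R) (e : R) : 0 <= e -> (0 <= a)%E ->
  (a <= (e ^+ 2)%:E)%E -> (a `^ 2^-1 <= e%:E)%E.
Proof.
move=> e0; case: a => [a|//|//] a0 ae; rewrite poweR_EFin lee_fin.
move: a0 ae; rewrite !lee_fin => a0 ae.
by rewrite powR12_sqrt// -(ger0_norm e0) -sqrtr_sqr ler_wsqrtr.
Qed.

Lemma cvge0_le (w : nat -> \bar R) : (forall n, (0 <= w n)%E) ->
  (forall e : R, 0 < e -> exists N, forall n, (N <= n)%N -> (w n <= e%:E)%E) ->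
  w @ \oo --> 0%E.
Proof.
move=> w0 we; apply/fine_cvgP; split.
  have [N HN] := we 1 ltr01; exists N => // n /= Nn.
  by rewrite ge0_fin_numE// (le_lt_trans (HN n Nn))// ltry.
apply/cvgrPdist_le => e e0; have [N HN] := we e e0; exists N => // n /= Nn.
have wn : w n \is a fin_num.
  by rewrite ge0_fin_numE// (le_lt_trans (HN n Nn))// ltry.
by rewrite sub0r normrN ger0_norm ?fine_ge0// -lee_fin fineK// HN.
Qed.

(** The Riesz-Fischer theorem for the sine system: by Parseval's identity the
    partial sums are Cauchy in quadratic mean. *)
Lemma formal_sum_exists (c : nat -> R) (B : R) :
  (forall n, \sum_(1 <= k < n) c k ^+ 2 <= B) -> exists x : L2_01 R, formal_sum c x.
Proof.
move=> cB; pose s n := \sum_(1 <= k < n.+1) c k ^+ 2.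
pose u n := sine_sum c 1 n.+1.
have s_nd : nondecreasing_seq s.
  by apply/nondecreasing_seqP => n; rewrite /s [leRHS]big_nat_recr//= lerDl sqr_ge0.
have cs : cvgn s.
  apply: (@nondecreasing_is_cvgn R s s_nd).
  by exists B => _ [n _ <-]; exact: cB.
have mu_ n : measurable_fun setT (u n).
  by apply: continuous_measurable_fun; exact: continuous_sine_sum.
have u_sub m n : (n <= m)%N -> forall x, u m x - u n x = sine_sum c n.+1 m.+1 x.
  move=> nm x; rewrite /u /sine_sum (@big_cat_nat _ _ _ n.+1 1 m.+1)//=.
  by rewrite addrAC subrr add0r.
have usq m n : (n <= m)%N ->
    (\int[mu01]_x ((u m x - u n x) ^+ 2)%:E = (s m - s n)%:E)%E.
  move=> nm; under eq_integral do rewrite u_sub//.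
  rewrite integral_sine_sum_sqr// /s [in RHS](@big_cat_nat _ _ _ n.+1 1 m.+1)//=.
  by rewrite addrAC subrr add0r.
have [f mf Hf] : exists2 f : R -> R, measurable_fun setT f &
  forall e : R, 0 < e -> exists N, forall n, (N <= n)%N ->
    (\int[mu01]_x ((f x - u n x) ^+ 2)%:E <= e%:E)%E.
  apply: (@L2_complete _ _ _ mu01 u mu_) => e e0.
  have [N _ HN] : \forall n \near \oo, `|limn s - s n| <= e.
    by have /cvgrPdist_le := cs; exact.
  have key m n : (N <= m)%N -> (N <= n)%N -> (n <= m)%N ->
      (\int[mu01]_x ((u m x - u n x) ^+ 2)%:E <= e%:E)%E.
    move=> Nm Nn nm; rewrite usq// lee_fin.
    have := HN n Nn; rewrite ler_norml => /andP[_]; apply: le_trans.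
    by rewrite lerB// nondecreasing_cvgn_le.
  exists N => m n Nm Nn; have [nm|mn] := leqP n m; first exact: key.
  under eq_integral do rewrite -sqrrN opprB.
  by apply: key => //; exact: ltnW.
have L2f : (L2_norm f < +oo)%E.
  have [N /(_ N (leqnn N)) HN] := Hf 1 ltr01.
  have mfu : measurable_fun setT (fun x => f x - u N x) by apply: measurable_funB.
  have -> : f = (fun x => f x - u N x) \+ u N by apply/funext => x /=; rewrite subrK.
  have mink := @minkowski_EFin _ _ _ mu01 (fun x => f x - u N x) (u N) 2 mfu (mu_ N).
  apply: le_lt_trans (mink _) _; first by rewrite ler1n.
  rewrite lte_add_pinfty// -/(L2_norm _) L2_normE poweR_lty//.
    by apply: le_lt_trans HN _; exact: ltry.
  by rewrite integral_sine_sum_sqr// ltry.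
have [x xf] := L2_space_of_fun mf L2f.
exists x; rewrite /formal_sum/=.
have E n : L2_norm (fun u => x u - \sum_(1 <= k < n.+1) c k * dirichlet_eigenfun k u) =
    L2_norm (fun v => f v - u n v).
  apply: L2_norm_ae.
  - by apply: measurable_funB; [exact: measurable_L2|exact: mu_].
  - exact: measurable_funB.
  - case: xf => N [mN N0 sN]; exists N; split => // v /= nv; apply: sN => /= fgv.
    by apply: nv; rewrite fgv.
rewrite (_ : (fun n => _) = fun n => L2_norm (fun v => f v - u n v)); last first.
  by apply/funext.
apply: cvge0_le => [n|e e0]; first exact: Lnorm_ge0.
have [N HN] := Hf _ (exprn_gt0 2 e0); exists N => n Nn.
rewrite L2_normE; apply: poweR_half_le; [exact: ltW| |exact: HN].
by apply: integral_ge0 => z _; rewrite lee_fin sqr_ge0.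
Qed.

End L2Space.

(** * Norms of formal sums *)

Section FormalSums.
Context (R : realType).
Local Notation mu01 := (@lebesgue01 R).

Lemma cvge0_near_le (w : nat -> \bar R) (e : R) : (forall n, (0 <= w n)%E) ->
  w @ \oo --> 0%E -> 0 < e -> \forall n \near \oo, (w n <= e%:E)%E.
Proof.
move=> w0 /fine_cvgP[wfin /cvgrPdist_le we] /we; apply: filterS2 wfin => n wn.
by rewrite /= sub0r normrN ger0_norm ?fine_ge0// -lee_fin fineK.
Qed.

Lemma L2_Lfun (f : R -> R) : measurable_fun setT f -> (L2_norm f < +oo)%E ->
  (f : measurableTypeR R -> R) \in Lfun mu01 2%:E.
Proof.
by move=> mf nf; rewrite inE; apply/andP; split; rewrite inE.
Qed.

Lemma L2_mul_integrable (f g : R -> R) :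
  measurable_fun setT f -> measurable_fun setT g ->
  (L2_norm f < +oo)%E -> (L2_norm g < +oo)%E ->
  mu01.-integrable setT (fun u => (f u * g u)%:E).
Proof.
move=> mf mg nf ng; apply/Lfun1_integrable.
exact: (Lfun2_mul_Lfun1 (L2_Lfun mf nf) (L2_Lfun mg ng)).
Qed.

Lemma L2_inner_cauchy_schwarz (f g : R -> R) :
  measurable_fun setT f -> measurable_fun setT g ->
  (L2_norm f < +oo)%E -> (L2_norm g < +oo)%E ->
  (`|L2_inner f g|%:E <= L2_norm f * L2_norm g)%E.
Proof.
move=> mf mg nf ng.
have ifg := L2_mul_integrable mf mg nf ng.
rewrite /L2_inner EFin_normr_Rintegral//.
apply: (le_trans (le_abse_integral _ measurableT (measurable_int _ ifg))).
have := @hoelder _ _ _ mu01 f g 2 2 mf mg.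
by rewrite Lnorm1; apply=> //; rewrite [RHS]splitr !div1r.
Qed.

Lemma L2_norm_eigenfun (k : nat) : (1 <= k)%N ->
  L2_norm (@dirichlet_eigenfun R k) = 1%E.
Proof.
move=> k1; rewrite L2_normE.
have -> : (\int[mu01]_u (dirichlet_eigenfun k u ^+ 2)%:E = 1)%E.
  have := @integral_sine_sum_sqr R (fun=> 1) k k.+1 k1.
  rewrite big_nat1 expr1n => <-; apply: eq_integral => u _.
  by rewrite /sine_sum big_nat1 mul1r.
by rewrite poweR_EFin powR1.
Qed.

Lemma L2_norm_sine_sum (c : nat -> R) (n : nat) :
  L2_norm (sine_sum c 1 n) = (Num.sqrt (\sum_(1 <= k < n) c k ^+ 2))%:E.
Proof.
rewrite L2_normE integral_sine_sum_sqr// poweR_EFin powR12_sqrt//.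
by apply: sumr_ge0 => k _; exact: sqr_ge0.
Qed.

Lemma measurable_sine_sum (c : nat -> R) m n : measurable_fun setT (sine_sum c m n).
Proof. by apply: continuous_measurable_fun; exact: continuous_sine_sum. Qed.

Lemma L2_space_norm_lty (x : L2_01 R) : (L2_norm x < +oo)%E.
Proof. exact: (@Lebesgue_finite _ _ _ _ _ _ x). Qed.

Section FormalSum.
Context (c : nat -> R) (x : L2_01 R).
Context (cx : formal_sum c x).

Let res n (u : R) := x u - sine_sum c 1 n.+1 u.

Let m_res n : measurable_fun setT (res n).
Proof. by apply: measurable_funB; [exact: measurable_L2|exact: measurable_sine_sum]. Qed.

Let near_res e : 0 < e -> \forall n \near \oo, (L2_norm (res n) <= e%:E)%E.
Proof. by apply: cvge0_near_le => // n; exact: Lnorm_ge0. Qed.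

(** Taking the inner product with an eigenfunction is continuous by the
    Cauchy-Schwarz inequality, and it is known on partial sums. *)
Lemma L2_inner_formal_sum (k : nat) : (1 <= k)%N ->
  L2_inner x (@dirichlet_eigenfun R k) = c k.
Proof.
move=> k1; apply/eqP; rewrite -subr_eq0 -normr_le0; apply/ler_addgt0Pl => e e0.
rewrite addr0; near \oo => n.
have rn : (L2_norm (res n) <= e%:E)%E by near: n; exact: near_res.
have kn : (k < n.+1)%N by rewrite ltnS; near: n; exact: nbhs_infty_ge.
have mek : measurable_fun setT (@dirichlet_eigenfun R k).
  by apply: continuous_measurable_fun; exact: continuous_eigenfun.
have ek : (L2_norm (@dirichlet_eigenfun R k) < +oo)%E by rewrite L2_norm_eigenfun// ltry.
have rfin : (L2_norm (res n) < +oo)%E by rewrite (le_lt_trans rn)// ltry.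
have sfin : (L2_norm (sine_sum c 1 n.+1) < +oo)%E by rewrite L2_norm_sine_sum ltry.
have -> : L2_inner x (@dirichlet_eigenfun R k) - c k =
    L2_inner (res n) (@dirichlet_eigenfun R k).
  rewrite -(@L2_inner_sine_sum_eigenfun R c n.+1 k) ?k1// /L2_inner.
  rewrite -RintegralB//; last 2 first.
  - exact: (L2_mul_integrable (measurable_L2 x) mek (L2_space_norm_lty x) ek).
  - exact: (L2_mul_integrable (measurable_sine_sum _ _ _) mek sfin ek).
  by apply: eq_Rintegral => u _; rewrite /res mulrBl.
rewrite -lee_fin (le_trans (L2_inner_cauchy_schwarz (m_res n) mek rfin ek))//.
by rewrite L2_norm_eigenfun// mule1.
Unshelve. all: by end_near. Qed.

(** Half of Parseval's identity, by the triangle inequality through a partial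
    sum. *)
Lemma L2_norm_formal_sum_le (B : R) :
  (forall n, \sum_(1 <= k < n) c k ^+ 2 <= B) -> (L2_norm x <= (Num.sqrt B)%:E)%E.
Proof.
move=> cB; apply/lee_addgt0Pr => e e0; near \oo => n.
have rn : (L2_norm (res n) <= e%:E)%E by near: n; exact: near_res.
have -> : (x : R -> R) = sine_sum c 1 n.+1 \+ res n.
  by apply/funext => u; rewrite /res/= addrC subrK.
have mink := @minkowski_EFin _ _ _ mu01 (sine_sum c 1 n.+1) (res n) 2
  (measurable_sine_sum _ _ _) (m_res n).
apply: le_trans (mink _) _; first by rewrite ler1n.
apply: leeD => //; rewrite -/(L2_norm _) L2_norm_sine_sum lee_fin.
by rewrite ler_wsqrtr.
Unshelve. all: by end_near. Qed.

Lemma sobolev_norm_formal_sum (alpha : R) :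
  sobolev_norm alpha x =
  ((\sum_(1 <= k <oo) (dirichlet_eigenvalue R k `^ alpha * c k ^+ 2)%:E) `^ 2^-1)%E.
Proof.
rewrite /sobolev_norm; congr (_ `^ _)%E; apply: congr_lim; apply/funext => n.
rewrite !big_nat; apply: eq_bigr => k /andP[k1 _].
by rewrite L2_inner_formal_sum.
Qed.

End FormalSum.

Lemma dirichlet_eigenvalue_ge (k : nat) : k%:R ^+ 2 <= dirichlet_eigenvalue R k.
Proof.
rewrite /dirichlet_eigenvalue ler_peMr ?sqr_ge0//.
by rewrite exprn_ege1// (le_trans _ (pi_ge2 R))// ler1n.
Qed.

Lemma dirichlet_eigenvalue_ge1 (k : nat) : (1 <= k)%N -> 1 <= dirichlet_eigenvalue R k.
Proof.
move=> k1; apply: le_trans (dirichlet_eigenvalue_ge k).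
by rewrite exprn_ege1// ler1n.
Qed.

(** A bound on the powers of the partial sums bounds the partial sums, by
    [s <= max (1, s^p)], and passes to their limit [B]. *)
Lemma nneseries_exp_le (a : nat -> R) (p : nat) (D : R) :
  (0 < p)%N -> (forall k, 0 <= a k) ->
  (forall n, (\sum_(1 <= k < n) a k) ^+ p <= D) ->
  exists B : R, [/\ 0 <= B, B ^+ p <= D, forall n, \sum_(1 <= k < n) a k <= B &
    (\sum_(1 <= k <oo) (a k)%:E)%E = B%:E].
Proof.
move=> p0 a0 aD; pose s n := \sum_(1 <= k < n) a k.
have s0 n : 0 <= s n by apply: sumr_ge0.
have D1 : 0 <= D by rewrite (le_trans _ (aD 0%N))// exprn_ge0// s0.
have s_nd : nondecreasing_seq s.
  move=> m n mn; have [m1|m1] := leqP 1 m; last first.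
    by rewrite {1}/s big_geq ?s0// ltnW.
  by rewrite /s [leRHS](@big_cat_nat _ _ _ m 1 n)//= lerDl sumr_ge0.
have cs : cvgn s.
  apply: nondecreasing_is_cvgn => //; exists (1 + D) => _ [n _ <-].
  have [s1|s1] := leP (s n) 1; first by rewrite (le_trans s1)// lerDl.
  rewrite (@le_trans _ _ (s n ^+ p))//; last by rewrite (le_trans (aD n))// lerDr.
  by rewrite -[leLHS]expr1 ler_weXn2l// ltW.
exists (limn s); split.
- by apply: limr_ge => //; apply: nearW.
- have cp : s n ^+ p @[n --> \oo] --> limn s ^+ p.
    apply: (@continuous_cvg _ _ _ _ _ _ (fun z : R => z ^+ p)) => //.
    exact: exprn_continuous.
  rewrite -(cvg_lim _ cp)//; apply: limr_le; first exact: cvgP cp.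
  by apply: nearW => n; exact: aD.
- by move=> n; exact: nondecreasing_cvgn_le.
- apply/cvg_lim => //.
  rewrite (_ : (fun n => _) = fun n => (s n)%:E); last first.
    by apply/funext => n; rewrite sumEFin.
  by apply: cvg_EFin => //; apply: nearW.
Qed.

Lemma lee_expe (x y : \bar R) (n : nat) : (0 <= x)%E -> (x <= y)%E ->
  (x ^+ n <= y ^+ n)%E.
Proof.
move=> x0 xy; elim: n => [|n IH]; first by rewrite !expe0.
by rewrite !expeS lee_pmul ?expe_ge0.
Qed.

Lemma formal_norm_le (V : L2_01 R -> \bar R) (c : nat -> R) (x : L2_01 R) :
  formal_sum c x -> (formal_norm V c <= V x)%E.
Proof. by move=> cx; apply: ereal_inf_lbound; exists x. Qed.

Lemma formal_norm_ge0 (V : L2_01 R -> \bar R) (c : nat -> R) :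
  (forall x, 0 <= V x)%E -> (0 <= formal_norm V c)%E.
Proof. by move=> V0; apply: le_ereal_inf_tmp => _ [x _ <-]. Qed.

Lemma poweR_half_exp_even (B : R) (p : nat) : 0 <= B ->
  ((B%:E `^ 2^-1) ^+ (2 * p) = (B ^+ p)%:E)%E.
Proof.
by move=> B0; rewrite poweR_EFin -EFin_expe powR12_sqrt// exprM sqr_sqrtr.
Qed.

(** As the eigenvalues are at least [1] and [alpha >= 0], the weighted sums
    dominate the unweighted ones; a bound on them therefore controls both
    norms, and the existence of the sum. *)
Section WeightedCoefficients.
Context (alpha : R) (c : nat -> R) (p : nat) (D : R).
Context (alpha0 : 0 <= alpha).
Context (p0 : (0 < p)%N).
Context (cD : forall n,
  (\sum_(1 <= k < n) dirichlet_eigenvalue R k `^ alpha * c k ^+ 2) ^+ p <= D).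

Let a k := dirichlet_eigenvalue R k `^ alpha * c k ^+ 2.
Let a0 k : 0 <= a k.
Proof. by rewrite mulr_ge0 ?powR_ge0 ?sqr_ge0. Qed.

Let sqr_le n : \sum_(1 <= k < n) c k ^+ 2 <= \sum_(1 <= k < n) a k.
Proof.
rewrite !big_nat; apply: ler_sum => k /andP[k1 _]; rewrite ler_peMl ?sqr_ge0//.
by rewrite -(powRr0 (dirichlet_eigenvalue R k)) ler_powR// dirichlet_eigenvalue_ge1.
Qed.

Lemma formal_in_sobolev : formal_in (sobolev alpha) c.
Proof.
have [B [B0 _ aB aE]] := nneseries_exp_le p0 a0 cD.
have [x cx] := formal_sum_exists (fun n => le_trans (sqr_le n) (aB n)).
exists x => //; rewrite /sobolev/= (sobolev_norm_formal_sum cx).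
by rewrite -/a aE poweR_EFin ltry.
Qed.

Lemma formal_norm_sobolev_le : (formal_norm (sobolev_norm alpha) c ^+ (2 * p) <= D%:E)%E.
Proof.
have [B [B0 BD aB aE]] := nneseries_exp_le p0 a0 cD.
have [x cx] := formal_sum_exists (fun n => le_trans (sqr_le n) (aB n)).
rewrite (@le_trans _ _ (sobolev_norm alpha x ^+ (2 * p))%E)//.
  apply: lee_expe; first by apply: formal_norm_ge0 => y; exact: poweR_ge0.
  exact: formal_norm_le.
by rewrite (sobolev_norm_formal_sum cx) -/a aE poweR_half_exp_even.
Qed.

Lemma formal_norm_L2_le :
  (formal_norm (fun x : L2_01 R => L2_norm x) c ^+ (2 * p) <= D%:E)%E.
Proof.
have [B [B0 BD aB aE]] := nneseries_exp_le p0 a0 cD.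
have cB n := le_trans (sqr_le n) (aB n).
have [x cx] := formal_sum_exists cB.
rewrite (@le_trans _ _ ((B%:E `^ 2^-1) ^+ (2 * p))%E)//.
  apply: lee_expe; first by apply: formal_norm_ge0 => y; exact: Lnorm_ge0.
  apply: le_trans (formal_norm_le _ cx) _.
  by rewrite poweR_EFin powR12_sqrt// (L2_norm_formal_sum_le cx cB).
by rewrite poweR_half_exp_even.
Qed.

End WeightedCoefficients.

End FormalSums.

(** * Moments of the Ornstein-Uhlenbeck process *)

(** The integral of a nonnegative function is a supremum over the simple
    functions below it, which is monotone whether or not the function is
    measurable. *)
Lemma le_integral_nonmeasurable d (T : measurableType d) (R : realType)
    (mu : {measure set T -> \bar R}) (f g : T -> \bar R) :
  (forall x, 0 <= f x)%E -> (forall x, f x <= g x)%E ->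
  (\int[mu]_x f x <= \int[mu]_x g x)%E.
Proof.
move=> f0 fg; have g0 x : (0 <= g x)%E by exact: le_trans (f0 x) (fg x).
rewrite !ge0_integralTE//; apply: le_ereal_sup => _ [h hf <-].
by exists h => // x; exact: le_trans (hf x) (fg x).
Qed.

Lemma eigenvalue_powRN_sum_bounded (R : realType) (g : R) : 2^-1 < g ->
  exists2 W : R, 0 < W & forall n,
    \sum_(1 <= k < n) dirichlet_eigenvalue R k `^ (- g) <= W.
Proof.
move=> g1; have [W W0 HW] := @powR_sum_bounded R (2 * g) ltac:(lra).
exists W => // n; apply: le_trans (HW n).
rewrite !big_nat; apply: ler_sum => k /andP[k1 _].
rewrite !powRN powRrM -[2]/(2%:R) powR_mulrn//.
have k0 : 0 < k%:R :> R by rewrite ltr0n.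
rewrite lef_pV2 ?posrE ?powR_gt0 ?exprn_gt0//; last first.
  exact: lt_le_trans ltr01 (dirichlet_eigenvalue_ge1 R k1).
apply: ge0_ler_powR; rewrite ?nnegrE ?sqr_ge0//; first lra.
  exact: le_trans ler01 (dirichlet_eigenvalue_ge1 R k1).
exact: dirichlet_eigenvalue_ge.
Qed.

Section Moments.
Context (d : measure_display) (T : measurableType d) (R : realType).
Context (P : probability T R) (H : R) (beta : nat -> R -> T -> R).
Context (H0 : 0 < H).
Context (fbm_beta :
  forall k, (1 <= k)%N -> fractional_brownian_motion P H (beta k)).

Local Notation lam := (dirichlet_eigenvalue R).

(** The function [D] is the right-hand side of Jensen's inequality for the
    weights [W^-1 l_k^(- g)] and the values [W l_k^(2 H) c_k^2].  Its
    expectation is bounded by [fOU_moment_le], where the powers of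
    [l_k^(2 H)] cancel. *)
Lemma fOU_weighted_sum_dominated (alpha : R) (p : nat) :
  0 <= alpha -> alpha < 2 * H - 2^-1 -> (0 < p)%N ->
  exists M : R, forall t, 0 <= t -> exists D : T -> \bar R,
    [/\ P.-integrable setT D, forall w, (0 <= D w)%E,
        (\int[P]_w D w <= M%:E)%E &
        forall w, (D w < +oo)%E -> forall n,
          (\sum_(1 <= k < n) lam k `^ alpha * fOU beta t w k ^+ 2) ^+ p <= fine (D w)].
Proof.
move=> alpha0 alphaH p0.
pose g := 2 * H - alpha.
have [W W0 HW] : exists2 W : R, 0 < W & forall n, \sum_(1 <= k < n) lam k `^ (- g) <= W.
  by apply: eigenvalue_powRN_sum_bounded; rewrite /g; lra.
have [C C0 HC] := fOU_moment_le p0 H0.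
exists (W^-1 * W ^+ p * C * W) => t t0.
pose Z k w := fOU beta t w k.
pose q k := W^-1 * W ^+ p * (lam k `^ (- g) * (lam k `^ (2 * H)) ^+ p).
have q0 k : 0 <= q k.
  by rewrite !mulr_ge0 ?exprn_ge0 ?powR_ge0 ?invr_ge0// ltW.
have ev (z : R) : 0 <= z ^+ (2 * p) by rewrite exprM exprn_ge0// sqr_ge0.
have lam0 k : (1 <= k)%N -> 0 < lam k.
  by move=> k1; exact: lt_le_trans ltr01 (dirichlet_eigenvalue_ge1 R k1).
have ZM k : (1 <= k)%N -> measurable_fun setT (Z k) /\
    (\int[P]_w (Z k w ^+ (2 * p))%:E <= (C * (lam k `^ (- (2 * H))) ^+ p)%:E)%E.
  by move=> k1; exact: HC _ _ P (beta k) (lam k) t (fbm_beta k1) (lam0 k k1) t0.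
(* index shifted by one, so that the term of index 0 does not occur *)
pose F k w := (q k.+1 * Z k.+1 w ^+ (2 * p))%:E.
pose D w := (\sum_(0 <= k <oo) F k w)%E.
have F0 k w : (0 <= F k w)%E by rewrite lee_fin mulr_ge0.
have mZp k : measurable_fun setT (fun w => (Z k.+1 w ^+ (2 * p))%:E).
  by apply/measurable_EFinP; apply: measurable_funX; have [] := ZM k.+1 isT.
have mF k : measurable_fun setT (F k).
  apply/measurable_EFinP; apply: measurable_funM => //.
  by apply: measurable_funX; have [] := ZM k.+1 isT.
have mD : measurable_fun setT D by apply: ge0_emeasurable_sum.
have D0 w : (0 <= D w)%E by apply: nneseries_ge0.
have DM : (\int[P]_w D w <= (W^-1 * W ^+ p * C * W)%:E)%E.
  rewrite integral_nneseries//.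
  apply: (@le_trans _ _ (\sum_(0 <= k <oo) (W^-1 * W ^+ p * C * lam k.+1 `^ (- g))%:E)%E).
    apply: lee_nneseries => [k _ _|k _]; first exact: integral_ge0.
    under eq_integral do rewrite /F EFinM.
    rewrite ge0_integralZl//.
    2: by move=> w _; rewrite lee_fin.
    2: by rewrite lee_fin.
    have [_ Zk] := ZM k.+1 isT.
    apply: (le_trans (lee_wpmul2l _ Zk)); first by rewrite lee_fin.
    rewrite -EFinM lee_fin /q (powRN _ (2 * H)) exprVn.
    have l0 : (lam k.+1 `^ (2 * H)) ^+ p != 0.
      by rewrite gt_eqF// exprn_gt0// powR_gt0// lam0.
    by rewrite le_eqVlt; apply/orP; left; apply/eqP; field; rewrite l0 gt_eqF.
  apply: nneseries_le => [k|n].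
    by rewrite !mulr_ge0 ?exprn_ge0 ?powR_ge0 ?invr_ge0// ltW.
  rewrite -mulr_sumr ler_wpM2l//.
    by rewrite !mulr_ge0 ?exprn_ge0 ?invr_ge0// ltW.
  by have := HW n.+1; rewrite big_add1.
exists D; split => //.
  apply/integrableP; split => //.
  under eq_integral => w _ do rewrite gee0_abs//.
  by apply: le_lt_trans DM _; exact: ltry.
move=> w Dw n.
have -> : \sum_(1 <= k < n) lam k `^ alpha * fOU beta t w k ^+ 2 =
   \sum_(1 <= k < n) (W^-1 * lam k `^ (- g)) * (W * lam k `^ (2 * H) * Z k w ^+ 2).
  rewrite !big_nat; apply: eq_bigr => k /andP[k1 _].
  have -> : alpha = - g + 2 * H by rewrite /g; lra.
  rewrite powRD; last by rewrite (gt_eqF (lam0 k k1)) implybT.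
  by rewrite -/(Z k w); field; rewrite gt_eqF.
have [m pm] : exists m, p = m.+1 by exists p.-1; rewrite prednK.
rewrite pm; apply: le_trans (jensen_exprS _ _ _ _) _.
- by move=> k; rewrite mulr_ge0 ?powR_ge0// invr_ge0 ltW.
- move=> k; apply: mulr_ge0; last exact: sqr_ge0.
  by apply: mulr_ge0; [exact: ltW|exact: powR_ge0].
- by rewrite -mulr_sumr mulrC ler_pdivrMr// mul1r.
rewrite -pm -lee_fin fineK ?ge0_fin_numE//.
case: n => [|n]; first by rewrite big_geq.
rewrite big_add1 -sumEFin.
rewrite (eq_bigr (F ^~ w)); last first.
  move=> k _; rewrite /F /q; congr EFin; rewrite !exprMn exprM expr2 exprMn; ring.
exact: nneseries_lim_ge.
Qed.

Lemma fOU_formal_in_sobolev (alpha t : R) :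
  0 <= alpha -> alpha < 2 * H - 2^-1 -> 0 <= t ->
  {ae P, forall w, formal_in (sobolev alpha) (fOU beta t w)}.
Proof.
move=> alpha0 alphaH t0.
have [M /(_ t t0)[D [iD D0 _ HD]]] := fOU_weighted_sum_dominated alpha0 alphaH (ltn0Sn 0).
have := integrable_ae measurableT iD; apply: filterS => w /(_ I) Dw.
apply: (formal_in_sobolev alpha0 (ltn0Sn 0) (D := fine (D w))).
by apply: HD; rewrite -ge0_fin_numE.
Qed.

(** [N] stands for either of the two norms of the formal sum.  The domination
    by [D] holds at every point, since where [D] is infinite there is nothing
    to prove. *)
Lemma sup_moment_lty (alpha : R) (p : nat) (N : (nat -> R) -> \bar R) :
  0 <= alpha -> alpha < 2 * H - 2^-1 -> (0 < p)%N ->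
  (forall c, 0 <= N c)%E ->
  (forall c D, (forall n, (\sum_(1 <= k < n) lam k `^ alpha * c k ^+ 2) ^+ p <= D) ->
     (N c ^+ (2 * p) <= D%:E)%E) ->
  (ereal_sup [set \int[P]_w (N (fOU beta t w) ^+ (2 * p)) | t in `[0%R, +oo[] < +oo)%E.
Proof.
move=> alpha0 alphaH p0 N0 ND.
have [M HM] := fOU_weighted_sum_dominated alpha0 alphaH p0.
apply: (@le_lt_trans _ _ M%:E); last exact: ltry.
apply: ge_ereal_sup => _ [t /= t0 <-].
move: t0; rewrite in_itv/= andbT => t0.
have [D [iD D0 DM HD]] := HM t t0.
apply: le_trans DM; apply: le_integral_nonmeasurable => w; first exact: expe_ge0.
have [Dw|] := boolP (D w < +oo)%E; last by rewrite -leNgt leye_eq => /eqP ->; rewrite leey.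
by rewrite -[leRHS]fineK ?ge0_fin_numE//; apply: ND; exact: HD.
Qed.

End Moments.

Theorem proposition3p1 (d : measure_display) (T : measurableType d)
    (R : realType) (P : probability T R) (H : R)
    (beta : nat -> R -> T -> R) :
  (4^-1 < H < 2^-1) \/ (2^-1 < H < 1) ->
  (forall k, (1 <= k)%N -> fractional_brownian_motion P H (beta k)) ->
  independent_processes P [set k | (1 <= k)%N] beta ->
  [/\ forall t, 0 <= t ->
        {ae P, forall w, formal_in [set: L2_01 R] (fOU beta t w)},
      forall p : nat, (1 <= p)%N ->
        (ereal_sup [set \int[P]_w
                      (formal_norm (fun x : L2_01 R => L2_norm x) (fOU beta t w)
                         ^+ (2 * p)) | t in `[0%R, +oo[] < +oo)%E
    & forall alpha, 0 < alpha < 2 * H - 2^-1 ->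
        (forall t, 0 <= t ->
           {ae P, forall w, formal_in (sobolev alpha) (fOU beta t w)}) /\
        (forall p : nat, (1 <= p)%N ->
           (ereal_sup [set \int[P]_w
                         (formal_norm (sobolev_norm alpha) (fOU beta t w)
                            ^+ (2 * p)) | t in `[0%R, +oo[] < +oo)%E)].
Proof.
move=> Hrange fbm_beta _.
have H4 : 4^-1 < H by case: Hrange => /andP[]; lra.
have H0 : 0 < H by lra.
have a0 : 0 < 2 * H - 2^-1 by lra.
split.
- move=> t t0; have := fOU_formal_in_sobolev H0 fbm_beta (lexx 0) a0 t0.
  by apply: filterS => w [x _ cx]; exists x.
- move=> p p1; apply: (sup_moment_lty H0 fbm_beta (lexx 0) a0 p1) => [c|c D cD].
    by apply: formal_norm_ge0 => x; exact: Lnorm_ge0.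
  exact: formal_norm_L2_le (lexx 0) p1 cD.
- move=> alpha /andP[alpha0 alphaH]; split=> [t t0|p p1].
    have inV := fOU_formal_in_sobolev H0 fbm_beta (ltW alpha0) alphaH t0.
    exact: inV.
  apply: (sup_moment_lty H0 fbm_beta (ltW alpha0) alphaH p1) => [c|c D cD].
    by apply: formal_norm_ge0 => x; exact: poweR_ge0.
  exact: formal_norm_sobolev_le (ltW alpha0) p1 cD.
Qed.
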